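(* There exists an estimator $\widehat\alpha_n := \widehat\alpha_n(T_n^1,T_n^2)$ (a function of the pair of unlabeled trees, not depending on $\alpha$) such that for every $\alpha\in[0,1]$, if $(T_n^1,T_n^2)\sim\alpha\text{-}\mathrm{CUA}(n)$, then $\widehat\alpha_n\to\alpha$ in probability as $n\to\infty$.
   Context: Correlated uniform attachment (UA) trees with parameter $\alpha\in[0,1]$: two trees $(T_n^1,T_n^2)_{n\ge 0}$ are grown together, both starting from a single node labeled $0$. At each step $n\ge1$, independently of the past: with probability $\alpha$ (''aligned choice'') a single $i\in\{0,\dots,n-1\}$ is chosen uniformly at random and the new node $n$ is connected to node $i$ in both trees; with probability $1-\alpha$ (''independent choice'') $i_1,i_2\in\{0,\dots,n-1\}$ are chosen independently and uniformly, and the new node $n$ is connected to $i_1$ in the first tree and to $i_2$ in the second tree. $\alpha\text{-}\mathrm{CUA}(n)$ is the law of the resulting pair of unlabeled trees (each tree is observed only up to isomorphism, with the node labels forgotten). *)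

(* Defs.v *)
From HB Require Import structures.
From mathcomp Require Import all_boot all_order all_algebra all_fingroup.
From mathcomp Require Import generic_quotient.

Set Implicit Arguments.
Unset Strict Implicit.
Unset Printing Implicit Defensive.

Import Order.TTheory GRing.Theory Num.Theory.

Local Open Scope quotient_scope.
Local Open Scope ring_scope.

(* A labeled graph on the nodes 0, ..., n is the set of its edges, an edge
   being a two-element set of nodes. *)
Definition lgraph (n : nat) : finType := {set {set 'I_n.+1}}.

Definition isograph (n : nat) (E F : lgraph n) : bool :=
  [exists s : {perm 'I_n.+1}, F == [set s @: e | e : {set 'I_n.+1} in E]].

Lemma isograph_refl (n : nat) : reflexive (@isograph n).
Proof.
move=> E; apply/existsP; exists 1%g; apply/eqP.
rewrite -[LHS]imset_id; apply: eq_imset => e.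
by rewrite -[LHS]imset_id; apply: eq_imset => x; rewrite perm1.
Qed.

Lemma isograph_trans (n : nat) : transitive (@isograph n).
Proof.
move=> F E G /existsP[s /eqP->] /existsP[t /eqP->].
apply/existsP; exists (s * t)%g; apply/eqP.
rewrite -imset_comp; apply: eq_imset => e /=.
by rewrite -imset_comp; apply: eq_imset => x /=; rewrite permM.
Qed.

Lemma isograph_sym (n : nat) : symmetric (@isograph n).
Proof.
suff H : forall E F, @isograph n E F -> isograph F E.
  by move=> E F; apply/idP/idP; apply: H.
move=> E F /existsP[s /eqP->]; apply/existsP; exists s^-1%g; apply/eqP.
rewrite -imset_comp -[LHS]imset_id; apply: eq_imset => e /=.
rewrite -imset_comp -[LHS]imset_id; apply: eq_imset => x /=.
by rewrite permK.
Qed.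

Canonical isograph_equiv (n : nat) :=
  EquivRel (@isograph n) (@isograph_refl n) (@isograph_sym n)
           (@isograph_trans n).

(* Isomorphism is that of graphs: the original node 0 is not distinguished. *)
Definition ugraph (n : nat) := {eq_quot (isograph_equiv n)}.

Definition unlabel (n : nat) (E : lgraph n) : ugraph n := \pi_(ugraph n) E.

(* Adds the node n.+1 (ord_max) and joins it to the old node i. *)
Definition attach (n : nat) (E : lgraph n) (i : 'I_n.+1) : lgraph n.+1 :=
  [set ord_max; widen_ord (leqnSn n.+1) i]
    |: [set widen_ord (leqnSn n.+1) @: e | e : {set 'I_n.+1} in E].

(* The random choices made when the node n.+1 arrives: [inl i] is the aligned
   choice of i, [inr (i1, i2)] the independent choice of i1 and i2. *)
Definition step (n : nat) : finType := ('I_n.+1 + 'I_n.+1 * 'I_n.+1)%type.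

Definition step_mass (R : realFieldType) (alpha : R) (n : nat) (c : step n) : R :=
  match c with
  | inl _ => alpha * n.+1%:R^-1
  | inr _ => (1 - alpha) * (n.+1%:R^-1 * n.+1%:R^-1)
  end.

Definition target1 (n : nat) (c : step n) : 'I_n.+1 :=
  match c with inl i => i | inr ij => ij.1 end.

Definition target2 (n : nat) (c : step n) : 'I_n.+1 :=
  match c with inl i => i | inr ij => ij.2 end.

Fixpoint history (n : nat) : finType :=
  if n is m.+1 then (history m * step m)%type else unit.

(* The steps are independent, hence the product. *)
Fixpoint history_mass (R : realFieldType) (alpha : R) (n : nat) :
    history n -> R :=
  match n with
  | 0 => fun _ => 1
  | m.+1 => fun h => history_mass alpha h.1 * step_mass alpha h.2
  end.

Fixpoint tree1 (n : nat) : history n -> lgraph n :=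
  match n with
  | 0 => fun _ => set0
  | m.+1 => fun h => attach (tree1 h.1) (target1 h.2)
  end.

Fixpoint tree2 (n : nat) : history n -> lgraph n :=
  match n with
  | 0 => fun _ => set0
  | m.+1 => fun h => attach (tree2 h.1) (target2 h.2)
  end.

(* The probability that the pair of unlabeled trees belongs to A. *)
Definition CUA (R : realFieldType) (alpha : R) (n : nat)
    (A : pred (ugraph n * ugraph n)) : R :=
  \sum_(h : history n | A (unlabel (tree1 h), unlabel (tree2 h)))
     history_mass alpha h.

Lemma step_mass_sum (R : realFieldType) (alpha : R) (n : nat) :
  \sum_(c : step n) step_mass alpha c = 1.
Proof.
have n0 : n.+1%:R != 0 :> R by rewrite pnatr_eq0.
rewrite big_sumType /= !sumr_const card_prod card_ord.
rewrite -[X in X + _]mulr_natr -mulrA mulVf // mulr1.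
rewrite -[X in _ + X]mulr_natr natrM -!mulrA [X in (1 - alpha) * X]mulrCA.
by rewrite (mulrA n.+1%:R^-1 n.+1%:R) mulVf // mul1r mulVf // mulr1 addrC subrK.
Qed.

Lemma CUA_setT (R : realFieldType) (alpha : R) (n : nat) :
  CUA alpha (fun _ : ugraph n * ugraph n => true) = 1.
Proof.
rewrite /CUA; elim: n => [|n IHn]; first by rewrite /= sumr_const card_unit.
rewrite -[RHS]IHn -(pair_bigA _ (fun h c => history_mass alpha h * step_mass alpha c)) /=.
by apply: eq_bigr => h _; rewrite -mulr_sumr step_mass_sum mulr1.
Qed.

(* Main.v *)
(** Node [0] is joined to node [1] in both trees, and this edge is typically
    balanced: deleting it leaves two components of linear size.  Conversely,
    with high probability all balanced edges of either tree join nodes of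
    bounded label, so node [0] lies in both trees in a bounded set of
    candidates that the unlabeled tree determines.  The arrival times of the
    late children of a node can be read off, up to a bounded error, from the
    sizes of their subtrees: the child of label [j] carries about [n / j]
    nodes.  So for every candidate one can count the children that arrived in
    successive time windows.  Counts of one node are independent across the
    windows, and for a pair (v, v') of nodes of the two trees the centered and
    normalized counts have correlation close to [alpha] if v = v' and close to
    0 otherwise.  Averaging their products over many windows and maximizing
    over the pairs of candidates recovers [alpha].  All bounds are uniform in
    [alpha], so a diagonal choice of the parameters gives one estimator. *)

Require Import Defs.
From mathcomp Require Import all_boot all_order all_algebra all_fingroup.
From mathcomp Require Import generic_quotient.
From mathcomp Require Import zify ring lra.

Set Implicit Arguments.
Unset Strict Implicit.
Unset Printing Implicit Defensive.

Import Order.TTheory GRing.Theory Num.Theory.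

(** * Cuts of a tree *)

Section Cuts.
Local Open Scope nat_scope.

Definition crossing (n : nat) (E : lgraph n) (S : {set 'I_n.+1}) : lgraph n :=
  [set e in E | ~~ (e \subset S) && ~~ [disjoint e & S]].

(* For a tree [E]: [S] is the component of a neighbor [u] of [v] once the edge
   joining [v] to [u] is deleted. *)
Definition cut_at (n : nat) (E : lgraph n) (v : 'I_n.+1) (S : {set 'I_n.+1}) :=
  (v \notin S) && [exists u in S, crossing E S == [set [set v; u]]].

(* The child with label [j] has about [n / j] descendants, so this approximates
   the number of children of [v] with label at most [t]. *)
Definition ncut (n : nat) (E : lgraph n) (t : nat) (v : 'I_n.+1) :=
  #|[set S | cut_at E v S & n.+1 <= #|S| * t]|.

(** For a tree, these are the endpoints of edges whose deletion leaves two components, each with at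
    least a fraction [1 / k] of the nodes: the candidates for node 0. *)
Definition balanced (n : nat) (E : lgraph n) (k : nat) (v : 'I_n.+1) :=
  [exists S, [&& cut_at E v S, n.+1 <= #|S| * k & n.+1 <= #|~: S| * k]].

Definition relabel (n : nat) (s : {perm 'I_n.+1}) (E : lgraph n) : lgraph n :=
  [set s @: e | e : {set 'I_n.+1} in E].

(** * Invariance of cut statistics under relabeling *)

Section Relabel.
Variables (n : nat) (s : {perm 'I_n.+1}).
Let sinj : injective (fun S : {set 'I_n.+1} => s @: S) := imset_inj (@perm_inj _ s).

Lemma cut_at_relabel (E : lgraph n) v (S : {set 'I_n.+1}) :
  cut_at (relabel s E) (s v) (s @: S) = cut_at E v S.
Proof.
have crE : crossing (relabel s E) (s @: S) = [set s @: e | e : {set 'I_n.+1} in crossing E S].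
  have H (e : {set 'I_n.+1}) : (~~ (s @: e \subset s @: S) && ~~ [disjoint s @: e & s @: S])
     = (~~ (e \subset S) && ~~ [disjoint e & S]).
    rewrite -!setI_eq0 -imsetI; last by move=> ? ? _ _; apply: perm_inj.
    by rewrite imset_eq0 !(sameP setIidPl eqP) -imsetI ?(inj_eq sinj)// => ? ? _ _; apply: perm_inj.
  apply/setP => f; apply/idP/imsetP.
    rewrite inE => /andP[/imsetP[e eE ->]]; rewrite H => He.
    by exists e => //; rewrite inE eE.
  by move=> [e]; rewrite inE => /andP[eE He] ->; rewrite inE H He andbT imset_f.
rewrite /cut_at (mem_imset _ _ (@perm_inj _ s)); congr (_ && _).
have e2 u : [set [set s v; s u]] = [set s @: e | e : {set 'I_n.+1} in [set [set v; u]]].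
  by rewrite imset_set1 imsetU !imset_set1.
apply/existsP/existsP => -[u /andP[uS]].
  move/imsetP: uS => [w wS ->]; rewrite crE e2 (inj_eq (imset_inj sinj)) => ?.
  by exists w; rewrite wS.
by move=> H; exists (s u); rewrite imset_f// crE e2 (inj_eq (imset_inj sinj)).
Qed.

Lemma ncut_relabel (E : lgraph n) t v :
  ncut (relabel s E) t (s v) = ncut E t v.
Proof.
rewrite /ncut -[RHS](card_imset _ sinj); apply: eq_card => S'.
have [S ->] : exists S : {set 'I_n.+1}, S' = s @: S.
  exists (s^-1%g @: S'); rewrite -imset_comp -[LHS]imset_id.
  by apply: eq_imset => x /=; rewrite permKV.
rewrite inE cut_at_relabel (card_imset _ (@perm_inj _ s)).
by rewrite (mem_imset _ _ sinj) inE.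
Qed.

Lemma balanced_relabel (E : lgraph n) k v :
  balanced (relabel s E) k (s v) = balanced E k v.
Proof.
have H (S : {set 'I_n.+1}) : #|~: (s @: S)| = #|~: S|.
  apply: (@addnI #|S|); rewrite cardsC -(cardsC (s @: S)).
  by rewrite (card_imset _ (@perm_inj _ s)).
apply/existsP/existsP => -[S'].
  have [S ->] : exists S : {set 'I_n.+1}, S' = s @: S.
    exists (s^-1%g @: S'); rewrite -imset_comp -[LHS]imset_id.
    by apply: eq_imset => x /=; rewrite permKV.
  by rewrite cut_at_relabel (card_imset _ (@perm_inj _ s)) H => ?; exists S.
by move=> ?; exists (s @: S'); rewrite cut_at_relabel (card_imset _ (@perm_inj _ s)) H.
Qed.

End Relabel.

(** * Parents and descendants read off from the history *)

Definition target (n : nat) (b : bool) (c : step n) := if b then target1 c else target2 c.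

Definition tree (n : nat) (b : bool) (h : history n) := if b then tree1 h else tree2 h.

Lemma treeS n b (h : history n.+1) : tree b h = attach (tree b h.1) (target b h.2).
Proof. by case: b. Qed.

(* Junk value 0 outside of [0 < j <= n]. *)
Fixpoint par (b : bool) (n : nat) : history n -> nat -> nat :=
  match n with
  | 0 => fun _ _ => 0
  | m.+1 => fun h j => if j == m.+1 then target b h.2 : nat else par b h.1 j
  end.

(** Reflexive: a node is its own descendant. The value is false for [x] above [n]. *)
Fixpoint desc (b : bool) (n : nat) : history n -> nat -> nat -> bool :=
  match n with
  | 0 => fun _ u x => (u == 0) && (x == 0)
  | m.+1 => fun h u x =>
      if x == m.+1 then (u == m.+1) || desc b h.1 u (target b h.2) else desc b h.1 u x
  end.

Definition descs (b : bool) (n : nat) (h : history n) (u : nat) : {set 'I_n.+1} :=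
  [set x : 'I_n.+1 | desc b h u x].

Lemma par_lt b n (h : history n) j : 0 < j -> par b h j < j.
Proof.
elim: n h => [|n IH] h j0 //=; case: eqP => [->|_]; [exact: ltn_ord | exact: IH].
Qed.

Lemma par_old b n (h : history n.+1) j : j <= n -> par b h j = par b h.1 j.
Proof. by move=> /= jn; case: eqP => // e; move: jn; rewrite e ltnn. Qed.

(** Trades the recursion over the history for a recursion from a node to its parent, the form used
    to study cuts. *)
Lemma descE b n (h : history n) u x : x <= n ->
  desc b h u x = (x == u) || ((0 < x) && desc b h u (par b h x)).
Proof.
elim: n h x => [|n IH] h x; first by rewrite leqn0 => /eqP-> /=; rewrite (eq_sym 0) andbT orbF.
have dS y : desc b h u y = if y == n.+1 then (u == n.+1) || desc b h.1 u (target b h.2)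
  else desc b h.1 u y by [].
rewrite !dS [par _ _ _]/=.
case: eqP => [->|/eqP xn].
  by move=> _; rewrite (eq_sym u) (ltn_eqF (ltn_ord _)).
move=> xle; have {}xle : x <= n by lia.
rewrite IH //; case: (posnP x) => [->|x0] //=.
by rewrite (ltn_eqF (leq_trans (par_lt b h.1 x0) (leqW xle))).
Qed.

Lemma desc_lt b n (h : history n) u x : x < u -> x <= n -> desc b h u x = false.
Proof.
elim/ltn_ind: x => x IH xu xn; rewrite descE// (ltn_eqF xu) /=.
case: (posnP x) => // x0 /=; have p := par_lt b h x0.
by apply: IH => //; lia.
Qed.

Lemma mem_tree b n (h : history n) e :
  reflect (exists2 x : 'I_n.+1, 0 < x & e = [set x; inord (par b h x)]) (e \in tree b h).
Proof.
apply: (iffP idP).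
  elim: n h e => [|n IH] h e; first by rewrite /tree; case: b; rewrite inE.
  rewrite treeS !inE => /orP[/eqP->|/imsetP[f /IH[x x0 ->] ->]].
    exists ord_max => //=; rewrite eqxx; congr [set _; _].
    by apply/val_inj; rewrite /= inordK //= ltnS ltnW.
  exists (widen_ord (leqnSn n.+1) x) => //.
  rewrite imsetU !imset_set1; congr [set _; _]; apply/val_inj => /=.
  rewrite (ltn_eqF (ltn_ord x)) !inordK //; apply: leq_trans (par_lt b h.1 x0) _.
      by have := ltn_ord x; lia.
    by have := ltn_ord x; lia.
move=> [x x0 ->] {e}; elim: n h x x0 => [|n IH] h x x0; first by move: (ltn_ord x); lia.
rewrite treeS !inE; have [xn|xn] := eqVneq (val x) n.+1.
  apply/orP; left; apply/eqP; congr [set _; _]; apply/val_inj => /=; first by rewrite xn.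
  by rewrite xn eqxx inordK // ltnS ltnW.
apply/orP; right; have xn' : x < n.+1 by rewrite ltn_neqAle xn -ltnS ltn_ord.
apply/imsetP; exists [set inord x; inord (par b h.1 x)].
  by have := IH h.1 (inord x); rewrite inordK //; apply.
rewrite imsetU !imset_set1; congr [set _; _]; apply/val_inj => /=; rewrite ?inordK //=.
  by rewrite (negPf xn).
  exact: leq_trans (par_lt b h.1 x0) (ltnW xn').
rewrite (negPf xn); exact: leq_trans (par_lt b h.1 x0) (ltnW (ltn_ord x)).
Qed.

(** * Classification of the cuts of a grown tree *)

Section TreeCuts.
Variables (b : bool) (n : nat) (h : history n).
Implicit Types (u v x y : 'I_n.+1) (S : {set 'I_n.+1}).
Let p x : 'I_n.+1 := inord (par b h x).

Lemma descE_ord (u : nat) x :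
  desc b h u x = (x == u :> nat) || ((0 < x) && desc b h u (par b h x)).
Proof. by apply: descE; rewrite -ltnS. Qed.

Lemma val_p x : 0 < x -> p x = par b h x :> nat.
Proof. by move=> x0; rewrite inordK //; have := par_lt b h x0; have := ltn_ord x; lia. Qed.

Lemma crossing2 S x y :
  (~~ ([set x; y] \subset S) && ~~ [disjoint [set x; y] & S]) = (x \in S) (+) (y \in S).
Proof.
rewrite subUset !sub1set -setI_eq0 setIUl setU_eq0 !setI_eq0 !disjoints1.
by case: (x \in S); case: (y \in S).
Qed.

Lemma crossing_compl (E : lgraph n) S : crossing E (~: S) = crossing E S.
Proof.
by apply/setP => e; rewrite !inE !disjoints_subset setCK; congr (_ && _); rewrite andbC.
Qed.

(** Parents have smaller labels, so an edge determines its child as its larger endpoint. *)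
Lemma edge_inj x y : 0 < x -> 0 < y -> [set x; p x] = [set y; p y] -> x = y.
Proof.
move=> x0 y0 e.
have px := par_lt b h x0; have py := par_lt b h y0.
have := set21 x (p x); rewrite e !inE => /orP[/eqP//|/eqP xpy].
have := set21 y (p y); rewrite -e !inE => /orP[/eqP//|/eqP ypx].
by have := val_p y0; rewrite -xpy; have := val_p x0; rewrite -ypx; lia.
Qed.

Lemma descs_cut x : 0 < x -> crossing (tree b h) (descs b h x) = [set [set x; p x]].
Proof.
move=> x0; apply/setP => e; rewrite !inE.
apply/andP/eqP => [[/mem_tree[y y0 ->]]|->].
  rewrite crossing2 !inE -/(p y) val_p // (descE_ord x y) y0 /=.
  case: eqP => [/val_inj ->//|_] /=; by rewrite addbb.
split; first by apply/mem_tree; exists x.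
rewrite crossing2 !inE descE_ord eqxx /= val_p //.
rewrite desc_lt //; have := par_lt b h x0; have := ltn_ord x; lia.
Qed.

(** Membership in [S] is constant along every edge except the one above [x], so it propagates from
    node 0 and from [x] to the whole tree. *)
Lemma cut_descs x S : 0 < x -> x \in S ->
  crossing (tree b h) S = [set [set x; p x]] -> S = descs b h x.
Proof.
move=> x0 xS crS.
have up y : 0 < y -> y != x -> (y \in S) = (p y \in S).
  move=> y0 yx; have : [set y; p y] \notin crossing (tree b h) S.
    rewrite crS inE; apply: contra yx => /eqP e; apply/eqP; exact: edge_inj.
  rewrite inE crossing2 => /nandP[/mem_tree[]|/negPn]; first by exists y.
  by case: (y \in S); case: (_ \in S).
have pxS : p x \notin S.
  have : [set x; p x] \in crossing (tree b h) S by rewrite crS set11.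
  by rewrite inE crossing2 xS => /andP[_].
(* The path from [y] to node 0 only meets labels below [x], hence avoids the edge above [x]. *)
have low (y : nat) : y < x -> (inord y \in S) = (ord0 \in S).
  elim/ltn_ind: y => y IH yx; have yn : y < n.+1 by have := ltn_ord x; lia.
  case: (posnP y) => [->|y0]; first by congr (_ \in S); apply/val_inj; rewrite /= inordK.
  rewrite up ?inordK //; last by apply/eqP => e; move: yx; rewrite -e inordK // ltnn.
  have py := par_lt b h y0.
  by rewrite /p inordK // IH //; lia.
have S0 : ord0 \notin S by rewrite -(low (par b h x)) ?par_lt.
apply/setP => y; rewrite inE.
have [k] := ubnP (nat_of_ord y); elim: k y => // k IH y yk.
rewrite descE_ord; case: eqP => [/val_inj->//|/eqP yx] /=.
case: (posnP (nat_of_ord y)) => [y0|y0] /=.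
  by apply/negbTE; rewrite (_ : y = ord0) //; apply/val_inj.
by rewrite up // IH ?val_p //; have := par_lt b h y0; lia.
Qed.

Lemma cut_atP v S :
  reflect ((exists2 u : 'I_n.+1, 0 < u & par b h u = v /\ S = descs b h u)
           \/ (0 < v /\ S = ~: descs b h v))
    (cut_at (tree b h) v S).
Proof.
apply: (iffP andP) => [[vS /existsP[u /andP[uS /eqP crS]]]|].
  have : [set v; u] \in crossing (tree b h) S by rewrite crS set11.
  rewrite inE => /andP[/mem_tree[x x0 e] _].
  have := set21 x (inord (par b h x)); rewrite -e !inE => /orP[/eqP xv|/eqP xu].
    right; rewrite -xv; split=> //; rewrite -[LHS]setCK; congr (~: _).
    by apply: cut_descs => //; rewrite ?inE ?xv // crossing_compl crS e xv.
  left; exists x => //; split; last by apply: cut_descs => //; rewrite ?xu // crS e xu.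
  have := set21 v u; rewrite e !inE => /orP[/eqP vx|/eqP ->]; last by rewrite val_p.
  by move: vS; rewrite vx xu uS.
case=> [[u u0 [puv ->]]|[v0 ->]].
  have pu := par_lt b h u0; have pv : p u = v by apply/val_inj; rewrite /= val_p.
  split; first by rewrite inE desc_lt // -?puv //; have := ltn_ord u; lia.
  apply/existsP; exists u; rewrite inE descE_ord eqxx /=.
  by rewrite descs_cut // pv setUC.
split; first by rewrite !inE descE_ord eqxx.
have pv := par_lt b h v0.
apply/existsP; exists (p v); rewrite !inE val_p // desc_lt //=; last by have := ltn_ord v; lia.
by rewrite crossing_compl descs_cut.
Qed.

(** A cut at [v] leads to a child or to the parent; the latter accounts for the extra 1. Distinct
    children give distinct sets because a node is the least label among its descendants. *)
Lemma ncut_bounds (t : nat) v :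
  let U := [set u : 'I_n.+1 | [&& 0 < u, par b h u == v & n.+1 <= #|descs b h u| * t]] in
  #|U| <= ncut (tree b h) t v <= #|U|.+1.
Proof.
cbv zeta; set U := [set u | _].
have inj : {in U &, injective (fun u : 'I_n.+1 => descs b h u)}.
  move=> u u' _ _ e.
  have le (w w' : 'I_n.+1) : descs b h w = descs b h w' -> w' <= w.
    move=> ee; have : w \in descs b h w' by rewrite -ee inE descE_ord eqxx.
    by rewrite inE leqNgt; apply: contraL => lt; rewrite desc_lt // -ltnS.
  by apply/val_inj/eqP; rewrite eqn_leq !le.
rewrite -(card_in_imset inj); apply/andP; split.
  apply: subset_leq_card; apply/subsetP => S /imsetP[u]; rewrite inE => /and3P[u0 /eqP pu c] ->.
  by rewrite inE c andbT; apply/cut_atP; left; exists u.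
apply: (@leq_trans #|(~: descs b h v) |: [set descs b h (nat_of_ord u) | u : 'I_n.+1 in U]|).
  apply: subset_leq_card; apply/subsetP => S; rewrite inE => /andP[/cut_atP[[u u0 [pu ->]] c|[_ ->] _]].
    by rewrite !inE; apply/orP; right; apply/imsetP; exists u; rewrite // inE u0 pu eqxx.
  by rewrite !inE eqxx.
by rewrite cardsU1; case: (_ \notin _).
Qed.

End TreeCuts.
End Cuts.

(** * Moments along the growth of the trees *)

Section Expectation.
Local Open Scope ring_scope.
Variables (R : realFieldType) (alpha : R).
Hypothesis alpha01 : 0 <= alpha <= 1.

Definition mean (n : nat) (f : history n -> R) : R := \sum_h history_mass alpha h * f h.
Definition smean (n : nat) (f : step n -> R) : R := \sum_c step_mass alpha c * f c.

Lemma step_mass_ge0 n (c : step n) : 0 <= step_mass alpha c.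
Proof. by case/andP: alpha01 => a0 a1; case: c => ? /=; rewrite !mulr_ge0 ?subr_ge0 ?invr_ge0. Qed.

Lemma history_mass_ge0 n (h : history n) : 0 <= history_mass alpha h.
Proof. by elim: n h => [|n IH] h //=; rewrite mulr_ge0 // step_mass_ge0. Qed.

Lemma meanS n (f : history n.+1 -> R) : mean f = mean (fun h => smean (fun c => f (h, c))).
Proof.
rewrite /mean /smean; under [RHS]eq_bigr do rewrite big_distrr /=.
by rewrite pair_bigA /=; apply: eq_bigr => -[h c] _ /=; rewrite mulrA.
Qed.

Lemma mean_eq n (f g : history n -> R) : f =1 g -> mean f = mean g.
Proof. by move=> e; apply: eq_bigr => h _; rewrite e. Qed.
Lemma smean_eq n (f g : step n -> R) : f =1 g -> smean f = smean g.
Proof. by move=> e; apply: eq_bigr => h _; rewrite e. Qed.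
Lemma meanD n (f g : history n -> R) : mean (fun h => f h + g h) = mean f + mean g.
Proof. by rewrite -big_split; apply: eq_bigr => h _; rewrite mulrDr. Qed.
Lemma smeanD n (f g : step n -> R) : smean (fun h => f h + g h) = smean f + smean g.
Proof. by rewrite -big_split; apply: eq_bigr => h _; rewrite mulrDr. Qed.
Lemma meanZ n a (f : history n -> R) : mean (fun h => a * f h) = a * mean f.
Proof. by rewrite big_distrr; apply: eq_bigr => h _; rewrite mulrCA. Qed.
Lemma smeanZ n a (f : step n -> R) : smean (fun h => a * f h) = a * smean f.
Proof. by rewrite big_distrr; apply: eq_bigr => h _; rewrite mulrCA. Qed.
Lemma smean_cst n a : smean (fun _ : step n => a) = a.
Proof. by rewrite /smean -mulr_suml step_mass_sum mul1r. Qed.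
Lemma mean_cst n a : mean (fun _ : history n => a) = a.
Proof. by rewrite /mean -mulr_suml; have := CUA_setT alpha n; rewrite /CUA => ->; rewrite mul1r. Qed.
Lemma mean_sum n (I : Type) (r : seq I) (P : pred I) (f : I -> history n -> R) :
  mean (fun h => \sum_(i <- r | P i) f i h) = \sum_(i <- r | P i) mean (f i).
Proof. by rewrite exchange_big; apply: eq_bigr => h _; rewrite big_distrr. Qed.
Lemma mean_le n (f g : history n -> R) : (forall h, f h <= g h) -> mean f <= mean g.
Proof. by move=> le; apply: ler_sum => h _; rewrite ler_wpM2l // history_mass_ge0. Qed.
Lemma smean_le n (f g : step n -> R) : (forall h, f h <= g h) -> smean f <= smean g.
Proof. by move=> le; apply: ler_sum => h _; rewrite ler_wpM2l // step_mass_ge0. Qed.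
Lemma mean_ge0 n (f : history n -> R) : (forall h, 0 <= f h) -> 0 <= mean f.
Proof. by move=> f0; apply: sumr_ge0 => h _; rewrite mulr_ge0 // history_mass_ge0. Qed.

Lemma sum_cst n (a : R) : \sum_(i < n.+1) a = n.+1%:R * a.
Proof. by rewrite sumr_const card_ord mulr_natl. Qed.

Lemma smean_target2 n (F : 'I_n.+1 -> 'I_n.+1 -> R) :
  smean (fun c : step n => F (target true c) (target false c)) =
  alpha * n.+1%:R^-1 * \sum_i F i i
  + (1 - alpha) * (n.+1%:R^-1 * n.+1%:R^-1) * \sum_i \sum_j F i j.
Proof.
rewrite /smean big_sumType /=; congr (_ + _); rewrite -big_distrr //=.
by rewrite pair_bigA.
Qed.

(** Each tree alone is a uniform attachment tree: the dependence on [alpha] cancels. *)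
Lemma smean_target n b (f : 'I_n.+1 -> R) :
  smean (fun c : step n => f (target b c)) = n.+1%:R^-1 * \sum_i f i.
Proof.
have n0 : n.+1%:R != 0 :> R by rewrite pnatr_eq0.
case: b.
  rewrite (smean_target2 (fun i _ => f i)).
  under [X in _ + _ * X]eq_bigr do rewrite sum_cst.
  by rewrite -mulr_sumr; move: n.+1%:R n0 => a n0; field.
rewrite (smean_target2 (fun _ j => f j)).
by rewrite [X in _ + _ * X]sum_cst; move: n.+1%:R n0 => a n0; field.
Qed.

(* [f] depends only on the first [t] steps. *)
Definition frozen (t : nat) (f : forall n, history n -> R) :=
  forall n (h : history n.+1), (t <= n)%N -> f n.+1 h = f n h.1.

Lemma mean_frozen t (f : forall n, history n -> R) n :
  frozen t f -> (t <= n)%N -> mean (f n) = mean (f t).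
Proof.
move=> fr; elim: n => [|n IH]; first by rewrite leqn0 => /eqP->.
rewrite leq_eqVlt => /orP[/eqP->//|tn]; rewrite -IH // meanS.
by apply: mean_eq => h; rewrite -[RHS](@smean_cst n); apply: smean_eq => c; rewrite fr.
Qed.

(** Centered indicator that the node [n.+1] attaches to [v], among [n.+1] possible parents. *)
Definition cstep (n v i : nat) : R := (i == v)%:R - n.+1%:R^-1.

Lemma sum_eq_nat n v : (v <= n)%N -> \sum_(i < n.+1) ((i == v :> nat)%:R : R) = 1.
Proof.
move=> vn; rewrite (bigD1 (inord v)) //= inordK // eqxx big1 ?addr0 // => i ne.
by case: eqP => // e; move: ne; rewrite -e inord_val eqxx.
Qed.

Lemma smean_cstep n b v : (v <= n)%N -> smean (fun c : step n => cstep n v (target b c)) = 0.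
Proof.
move=> vn; rewrite (smean_target b (fun i => cstep n v i)) big_split /= sum_eq_nat //.
rewrite sum_cst; have n0 : n.+1%:R != 0 :> R by rewrite pnatr_eq0.
by move: n.+1%:R n0 => a n0; field.
Qed.

Lemma smean_cstep2 n b v : (v <= n)%N -> smean (fun c : step n => cstep n v (target b c) ^+ 2) <= n.+1%:R^-1.
Proof.
have n0 : 0 < n.+1%:R :> R by rewrite ltr0n.
move=> vn; rewrite (smean_target b (fun i => cstep n v i ^+ 2)).
have e (i : 'I_n.+1) : cstep n v i ^+ 2 = (i == v :> nat)%:R * (1 - 2 * n.+1%:R^-1) + n.+1%:R^-2.
  by rewrite /cstep; move: n.+1%:R n0 => a n0; case: eqP => _ /=; field; rewrite gt_eqF.
under eq_bigr do rewrite e.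
rewrite big_split /= -mulr_suml sum_eq_nat // sum_cst.
move: n.+1%:R n0 {e} => a n0.
rewrite -[leRHS]mulr1 ler_pM2l ?invr_gt0 // (_ : 1 * (1 - 2 * a^-1) + a * a^-2 = 1 - a^-1); last by field; rewrite gt_eqF.
by rewrite lerBlDr lerDl invr_ge0 ltW.
Qed.

Lemma cstep_norm n v i : `|cstep n v i| <= 1.
Proof.
have n1 : 0 <= (n.+1%:R^-1 : R) <= 1 by rewrite invr_ge0 ler0n invf_le1 ?ltr0n // ler1n.
rewrite /cstep ler_norml; move: n.+1%:R^-1 n1 => a /andP[a0 a1].
by case: eqP => _ /=; lra.
Qed.

Lemma smean_cstep4 n b v : (v <= n)%N -> smean (fun c : step n => cstep n v (target b c) ^+ 4) <= n.+1%:R^-1.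
Proof.
move=> vn; apply: le_trans (smean_cstep2 b vn); apply: smean_le => c.
have := cstep_norm n v (target b c); set p := cstep _ _ _ => p1.
rewrite (exprM p 2 2) -[leRHS]mulr1 [leLHS]expr2 ler_wpM2l ?sqr_ge0 //.
by rewrite -real_normK ?num_real // expr_le1.
Qed.

(** An independent choice contributes 0 because both factors are centered; an aligned one
    contributes the covariance of two indicators of a single uniform node. This is the signal that
    the estimator detects. *)
Lemma smean_cstep_mul n v v' : (v <= n)%N -> (v' <= n)%N ->
  smean (fun c : step n => cstep n v (target true c) * cstep n v' (target false c)) =
  alpha * (v == v')%:R * n.+1%:R^-1 - alpha * n.+1%:R^-2.
Proof.
move=> vn vn'; have n0 : n.+1%:R != 0 :> R by rewrite pnatr_eq0.
rewrite (smean_target2 (fun i j => cstep n v i * cstep n v' j)).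
have z (w : nat) : (w <= n)%N -> \sum_(i < n.+1) cstep n w i = 0.
  move=> wn; rewrite big_split /= sum_eq_nat // sum_cst.
  by move: n.+1%:R n0 => a n0; field.
under [X in _ + _ * X]eq_bigr do rewrite -mulr_sumr z // mulr0.
rewrite big1_eq mulr0 addr0.
have e (i : 'I_n.+1) : cstep n v i * cstep n v' i = (i == v :> nat)%:R * ((v == v')%:R)
    - (i == v :> nat)%:R * n.+1%:R^-1 - cstep n v' i * n.+1%:R^-1.
  rewrite {1}/cstep mulrBl; congr (_ - _); last by rewrite mulrC.
  rewrite /cstep; case: (eqVneq (i : nat) v) => [->|_] /=; last by rewrite !mul0r subr0.
  by rewrite !mul1r.
under eq_bigr do rewrite e.
rewrite big_split /= sumrN big_split /= sumrN -!mulr_suml sum_eq_nat // z //.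
by move: n.+1%:R n0 => a n0; field.
Qed.

(* Step [j] adds the node [j.+1]: the window [s <= j < t] contains the labels
   [s.+1, ..., t]. *)
Definition cdeg (b : bool) (s t v : nat) (n : nat) (h : history n) : R :=
  \sum_(s <= j < t) ((par b h j.+1 == v)%:R - j.+1%:R^-1).

(** Expected number of children of a node [v <= s] in the window, and an upper bound for the
    variance of that number. *)
Definition harm (s t : nat) : R := \sum_(s <= j < t) j.+1%:R^-1.

Lemma cdeg_frozen b s t v : frozen t (cdeg b s t v).
Proof.
move=> n h tn; rewrite /cdeg big_nat [RHS]big_nat; apply: eq_bigr => j /andP[_ jt].
by rewrite par_old //; apply: leq_trans tn.
Qed.

Lemma cdegS b s t v (h : history t.+1) : (s <= t)%N ->
  cdeg b s t.+1 v h = cdeg b s t v h.1 + cstep t v (target b h.2).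
Proof. by move=> st; rewrite /cdeg big_nat_recr //= -/(cdeg b s t v h) cdeg_frozen // eqxx. Qed.

Lemma cdeg_nil b t v n (h : history n) : cdeg b t t v h = 0.
Proof. by rewrite /cdeg big_geq. Qed.

(** The increments after time [s] are martingale differences, hence orthogonal to any [F] of the
    past. *)
Lemma mean_cdeg F b s t v : (v <= s)%N -> (s <= t)%N -> frozen s F ->
  mean (fun h : history t => F t h * cdeg b s t v h) = 0.
Proof.
move=> vs; elim: t => [|t IH].
  by rewrite leqn0 => /eqP-> _; rewrite -[RHS](mean_cst 0 0); apply: mean_eq => h; rewrite cdeg_nil mulr0.
rewrite leq_eqVlt => /orP[/eqP<- _|st fr].
  by rewrite -[RHS](mean_cst s 0); apply: mean_eq => h; rewrite cdeg_nil mulr0.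
rewrite ltnS in st; rewrite meanS -[RHS](IH st fr); apply: mean_eq => h.
rewrite -[RHS]addr0 -[X in _ + X](mulr0 (F t h)) -(smean_cstep b (leq_trans vs st)) -smeanZ.
rewrite -[X in X + _](@smean_cst t) -smeanD; apply: smean_eq => c.
by rewrite cdegS //= fr // mulrDr.
Qed.

Lemma mean_cdeg2 b s t v : (v <= s)%N -> (s <= t)%N ->
  mean (fun h : history t => cdeg b s t v h ^+ 2) <= harm s t.
Proof.
move=> vs; elim: t => [|t IH].
  rewrite leqn0 => /eqP->; rewrite /harm big_geq // -[leRHS](mean_cst 0 0).
  by apply: mean_le => h; rewrite cdeg_nil expr0n.
rewrite leq_eqVlt => /orP[/eqP<-|st].
  by rewrite /harm big_geq // -[leRHS](mean_cst s 0); apply: mean_le => h; rewrite cdeg_nil expr0n.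
rewrite ltnS in st; rewrite meanS.
apply: (@le_trans _ _ (mean (fun h => cdeg b s t v h ^+ 2 + t.+1%:R^-1))).
  apply: mean_le => h.
  rewrite (@smean_eq _ _ (fun c => cdeg b s t v h ^+ 2 + ((2 * cdeg b s t v h) * cstep t v (target b c)
     + cstep t v (target b c) ^+ 2))); last by move=> c; rewrite cdegS //=; ring.
  rewrite smeanD smean_cst smeanD smeanZ smean_cstep ?(leq_trans vs) // mulr0 add0r lerD2l.
  by rewrite smean_cstep2 // (leq_trans vs).
by rewrite meanD mean_cst /harm big_nat_recr //= lerD2r IH.
Qed.

Lemma mean_cdeg4 b s t v : (v <= s)%N -> (s <= t)%N ->
  mean (fun h : history t => cdeg b s t v h ^+ 4) <= 3 * harm s t ^+ 2 + harm s t.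
Proof.
move=> vs; elim: t => [|t IH].
  rewrite leqn0 => /eqP->; rewrite /harm big_geq // expr0n mulr0 addr0 -[leRHS](mean_cst 0 0).
  by apply: mean_le => h; rewrite cdeg_nil expr0n.
rewrite leq_eqVlt => /orP[/eqP<-|st].
  rewrite /harm big_geq // expr0n mulr0 addr0 -[leRHS](mean_cst s 0).
  by apply: mean_le => h; rewrite cdeg_nil expr0n.
rewrite ltnS in st; rewrite meanS.
have vt := leq_trans vs st.
(* The third moment of a step does not depend on the history, so its term is a multiple of the mean
   of [cdeg] and vanishes; no bound on [k3] is required. *)
set k3 := smean (fun c : step t => cstep t v (target b c) ^+ 3).
apply: (@le_trans _ _ (mean (fun h => cdeg b s t v h ^+ 4 + (6 * t.+1%:R^-1) * cdeg b s t v h ^+ 2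
   + (4 * k3) * (1 * cdeg b s t v h) + t.+1%:R^-1))).
  apply: mean_le => h; set a := cdeg b s t v h.
  rewrite (@smean_eq _ _ (fun c => a ^+ 4 + ((4 * a ^+ 3) * cstep t v (target b c)
     + ((6 * a ^+ 2) * cstep t v (target b c) ^+ 2 + ((4 * a) * cstep t v (target b c) ^+ 3
     + cstep t v (target b c) ^+ 4))))); last by move=> c; rewrite cdegS //= -/a; ring.
  rewrite smeanD smean_cst smeanD smeanZ smean_cstep // mulr0 add0r !smeanD !smeanZ -/k3 -!addrA lerD2l.
  apply: lerD; last by rewrite mul1r mulrAC lerD2l smean_cstep4.
  by rewrite [leRHS]mulrAC ler_wpM2l ?smean_cstep2 // mulr_ge0 ?sqr_ge0.
have eX : mean (fun h : history t => cdeg b s t v h) = 0.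
  rewrite -(@mean_cdeg (fun _ _ => 1) b s t v vs st) //.
  by apply: mean_eq => h; rewrite mul1r.
rewrite !meanD !meanZ mean_cst eX !mulr0 addr0.
rewrite /harm big_nat_recr //= -/(harm s t).
have := IH st; have := mean_cdeg2 b vs st; have : 0 <= t.+1%:R^-1 :> R by rewrite invr_ge0.
set x4 := mean _; set x2 := mean _; set e := _^-1; nra.
Qed.

Definition xcov (s t v v' : nat) : R :=
  \sum_(s <= j < t) (alpha * (v == v')%:R * j.+1%:R^-1 - alpha * j.+1%:R^-2).

(** In the one-step expansion the mixed terms vanish by centering and the product of the two steps
    gives one summand of [xcov]. The factor [F] expresses conditioning on the first [s] steps. *)
Lemma mean_cdeg_mul F s t v v' : (v <= s)%N -> (v' <= s)%N -> (s <= t)%N -> frozen s F ->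
  mean (fun h : history t => F t h * (cdeg true s t v h * cdeg false s t v' h)) =
  xcov s t v v' * mean (F s).
Proof.
move=> vs vs'; elim: t => [|t IH].
  rewrite leqn0 => /eqP-> _; rewrite /xcov big_geq // mul0r.
  by rewrite -[RHS](mean_cst 0 0); apply: mean_eq => h; rewrite !cdeg_nil !mulr0.
rewrite leq_eqVlt => /orP[/eqP<- _|st fr].
  by rewrite /xcov big_geq // mul0r -[RHS](mean_cst s 0); apply: mean_eq => h; rewrite !cdeg_nil !mulr0.
rewrite ltnS in st; rewrite meanS /xcov big_nat_recr //= -/(xcov s t v v') mulrDl -IH //.
rewrite -(smean_cstep_mul (leq_trans vs st) (leq_trans vs' st)) -(mean_frozen fr st).
rewrite -meanZ -meanD; apply: mean_eq => h; set F0 := F t h.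
set a := cdeg true s t v h; set a' := cdeg false s t v' h.
rewrite (@smean_eq _ _ (fun c => F0 * (a * a') + ((F0 * a) * cstep t v' (target false c)
  + ((F0 * a') * cstep t v (target true c)
  + F0 * (cstep t v (target true c) * cstep t v' (target false c))))));
  last by move=> c; rewrite !cdegS //= fr // -/a -/a' -/F0; ring.
rewrite !smeanD smean_cst !smeanZ !smean_cstep ?(leq_trans vs) ?(leq_trans vs') //.
by rewrite !mulr0 !add0r [X in _ + X]mulrC.
Qed.

(** * The law of the number of descendants, as in a Polya urn *)

Definition ndesc (b : bool) (n : nat) (h : history n) (u : nat) : nat := #|descs b h u|.

Lemma ndesc_sum b n (h : history n) u : ndesc b h u = (\sum_(x < n.+1) desc b h u x)%N.
Proof. by rewrite /ndesc -sum1_card [RHS]big_mkcond /= big_mkcond /=; apply: eq_bigr => x _; rewrite inE; case: desc. Qed.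

Lemma ndescS b n (h : history n.+1) u : (u <= n)%N ->
  ndesc b h u = (ndesc b h.1 u + desc b h.1 u (target b h.2))%N.
Proof.
move=> un; rewrite !ndesc_sum big_ord_recr /= eqxx (ltn_eqF (un : (u < n.+1)%N)) /=.
congr (_ + _)%N.
by apply: eq_bigr => x _; rewrite (ltn_eqF (ltn_ord x)).
Qed.

Lemma ndesc_diag b u (h : history u.+1) : ndesc b h u.+1 = 1%N.
Proof.
rewrite ndesc_sum big_ord_recr big1 /= ?eqxx //= => x _.
by rewrite (ltn_eqF (ltn_ord x)) desc_lt // -ltnS.
Qed.

Lemma ndesc_gt0 b n (h : history n) u : (u <= n)%N -> (0 < ndesc b h u)%N.
Proof.
by move=> un; apply/card_gt0P; exists (inord u); rewrite inE descE // inordK ?eqxx.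
Qed.

Lemma ndesc_le b n (h : history n) u : (0 < u)%N -> (ndesc b h u <= n)%N.
Proof.
move=> u0.
suff: descs b h u \proper [set: 'I_n.+1] by move/proper_card; rewrite cardsT card_ord ltnS.
apply/properP; split; first exact: subsetT.
by exists ord0; rewrite ?inE // desc_lt.
Qed.

Lemma smean_desc n b (h : history n) u :
  smean (fun c : step n => (desc b h u (target b c))%:R) = n.+1%:R^-1 * (ndesc b h u)%:R.
Proof. by rewrite (smean_target b (fun i => (desc b h u i)%:R)) ndesc_sum natr_sum. Qed.

Definition avg (u : nat) (g : nat -> R) : R := u%:R^-1 * \sum_(i < u) g i.

Lemma mean_par b g u : (0 < u)%N -> mean (fun h : history u => g (par b h u)) = avg u g.
Proof.
case: u => // u _; rewrite meanS /=.
under mean_eq => h do (under smean_eq => c do rewrite eqxx; rewrite (smean_target b (fun i => g i))).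
by rewrite mean_cst.
Qed.

(* The pmf of the number of descendants of [u] is bounded by its value at 1,
   which is the product of the (1 - 1/(m+1)) for u <= m < n. *)
Lemma mean_ndesc_eq b g u n k : (forall i, 0 <= g i) -> (0 < u)%N -> (u <= n)%N ->
  mean (fun h : history n => g (par b h u) * (ndesc b h u == k)%:R) <= avg u g * u%:R / n%:R.
Proof.
move=> g0 u0; elim: n k => [|n IH] k; first by rewrite leqn0 => /eqP e; rewrite e in u0.
have A0 : 0 <= avg u g by rewrite mulr_ge0 ?invr_ge0 // sumr_ge0.
rewrite leq_eqVlt => /orP[/eqP un|un].
  rewrite -mulrA -un divff ?pnatr_eq0 -?lt0n // mulr1 -(mean_par b g u0).
  apply: mean_le => h; rewrite ler_piMr //; by case: (_ == _).
rewrite ltnS in un; rewrite meanS.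
have [k0|] := posnP k.
  apply: (@le_trans _ _ 0); last by rewrite mulr_ge0 ?invr_ge0 // mulr_ge0.
  rewrite -[leRHS](mean_cst n 0); apply: mean_le => h; rewrite -[leRHS](smean_cst n); apply: smean_le => c.
  by rewrite k0 (gtn_eqF (ndesc_gt0 _ _ (leqW un))) mulr0.
case: k => // k _.
have n0 : (0 < n)%N by apply: leq_trans un.
have nR : 0 < n%:R :> R by rewrite ltr0n.
have nR1 : 0 < n.+1%:R :> R by rewrite ltr0n.
(* The size becomes [k.+1] either by staying there or by growing from [k]. The weights [n - k] and
   [k] add up to [n], which turns the bound with denominator [n] into the one with [n.+1]. *)
rewrite (@mean_eq _ _ (fun h => n.+1%:R^-1 * ((n%:R - k%:R) * (g (par b h u) * (ndesc b h u == k.+1)%:R)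
   + k%:R * (g (par b h u) * (ndesc b h u == k)%:R)))); last first.
  move=> h.
  rewrite (@smean_eq _ _ (fun c => g (par b h u) * (ndesc b h u == k.+1)%:R
     + (g (par b h u) * ((ndesc b h u == k)%:R - (ndesc b h u == k.+1)%:R))
        * (desc b h u (target b c))%:R)); last first.
    move=> c; rewrite par_old // ndescS //=; case: desc; rewrite /= ?addn0 ?mulr0 ?addr0 //.
    by rewrite addn1 eqSS; ring.
  rewrite smeanD smean_cst smeanZ smean_desc.
  have [->|_] := eqVneq (ndesc b h u) k.
    by rewrite (ltn_eqF (ltnSn k)) /=; field; rewrite nat1r gt_eqF.
  have [->|_] := eqVneq (ndesc b h u) k.+1; rewrite /=; last by field; rewrite nat1r gt_eqF.
  by rewrite /=; field; rewrite nat1r gt_eqF.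
rewrite meanZ meanD !meanZ mulrC ler_pM2r ?invr_gt0 //.
have [kn|nk] := leqP k n.
  apply: (@le_trans _ _ ((n%:R - k%:R) * (avg u g * u%:R / n%:R) + k%:R * (avg u g * u%:R / n%:R))).
    by apply: lerD; apply: ler_wpM2l; rewrite ?subr_ge0 ?ler_nat ?IH.
  by rewrite -mulrDl subrK mulrC divfK // gt_eqF.
have z k' : (n < k')%N -> mean (fun h : history n => g (par b h u) * (ndesc b h u == k')%:R) = 0.
  move=> nk'; rewrite -[RHS](mean_cst n 0); apply: mean_eq => h.
  by rewrite ltn_eqF ?mulr0 //; apply: leq_ltn_trans nk'; exact: ndesc_le.
by rewrite !z ?(ltnW nk) ?leqW // !mulr0 addr0 mulr_ge0 ?invr_ge0 // mulr_ge0.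
Qed.

(** A subtree of size [D] grows with probability [D / (n + 1)], so each step multiplies the mean of
    [D (D + 1)] by [(n + 3) / (n + 1)]. The start is [D = 1] at time [u], when the parent of [u] is
    already fixed. *)
Lemma mean_ndesc2 b g u n : (0 < u)%N -> (u <= n)%N ->
  mean (fun h : history n => g (par b h u) * ((ndesc b h u)%:R * (ndesc b h u).+1%:R)) =
  2 * avg u g * (n.+1%:R * n.+2%:R) / (u.+1%:R * u.+2%:R).
Proof.
move=> u0; elim: n => [|n IH]; first by rewrite leqn0 => /eqP e; rewrite e in u0.
have nR1 m : m.+1%:R != 0 :> R by rewrite pnatr_eq0.
rewrite leq_eqVlt => /orP[/eqP un|un].
  rewrite -un mulfK ?mulf_neq0 // -(mean_par b g u0) -meanZ; apply: mean_eq => h.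
  by subst u; rewrite ndesc_diag mul1r mulrC.
rewrite ltnS in un; rewrite meanS.
rewrite (@mean_eq _ _ (fun h => (n.+3%:R / n.+1%:R) * (g (par b h u) * ((ndesc b h u)%:R * (ndesc b h u).+1%:R)))).
  by rewrite meanZ IH //; field; have := ler0n R n; have := ler0n R u => *; rewrite !lt0r_neq0 //; lra.
move=> h; set d := ndesc b h u.
rewrite (@smean_eq _ _ (fun c => g (par b h u) * (d%:R * d.+1%:R) + (g (par b h u) * (2 * d.+1%:R))
     * (desc b h u (target b c))%:R)); last first.
  move=> c; rewrite par_old // ndescS //= -/d; case: desc; rewrite ?addn0 ?mulr0 ?addr0 //.
  by rewrite addn1 -!natr1; ring.
by rewrite smeanD smean_cst smeanZ smean_desc -/d -!natr1; field; rewrite !natr1.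
Qed.

End Expectation.

(** * Subtree sizes *)

Section Tails.
Local Open Scope ring_scope.
Variables (R : realFieldType) (alpha : R).
Hypothesis alpha01 : 0 <= alpha <= 1.
Local Notation mean := (mean alpha).

Definition Pr (n : nat) (A : pred (history n)) : R := mean (fun h => (A h)%:R).

Lemma Pr_le n (A B : pred (history n)) : (forall h, A h -> B h) -> Pr A <= Pr B.
Proof. by move=> AB; apply: mean_le => // h; rewrite ler_nat leq_b1 || case: (A h) (AB h) => // ->. Qed.

Lemma Pr_or n (A B : pred (history n)) : Pr (fun h => A h || B h) <= Pr A + Pr B.
Proof. by rewrite /Pr -meanD; apply: mean_le => // h; case: (A h); case: (B h); rewrite /= ?addr0 ?add0r ?lerDl. Qed.

Lemma Pr_exists n (I : finType) (A : I -> pred (history n)) (a : R) :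
  (forall i, Pr (A i) <= a) -> Pr (fun h => [exists i, A i h]) <= #|I|%:R * a.
Proof.
move=> le; apply: (@le_trans _ _ (\sum_i Pr (A i))).
  rewrite /Pr -mean_sum; apply: mean_le => // h; case: existsP => [[i Ai]|_]; last by rewrite sumr_ge0.
  by rewrite (bigD1 i) //= Ai lerDl sumr_ge0.
apply: (@le_trans _ _ (\sum_(i : I) a)); first exact: ler_sum.
by rewrite sumr_const mulr_natl.
Qed.

Lemma Pr_markov n (f : history n -> R) (a : R) : 0 < a -> (forall h, 0 <= f h) ->
  Pr (fun h => a < f h) <= mean f / a.
Proof.
move=> a0 f0; rewrite mulrC -meanZ; apply: mean_le => // h; rewrite mulrC ler_pdivlMr //.
by case: ltP => /= [/ltW|_]; rewrite ?mul1r ?mul0r.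
Qed.

Lemma mean_ndesc_seq b g u n (r : seq nat) : (forall i, 0 <= g i) -> (0 < u)%N -> (u <= n)%N ->
  mean (fun h : history n => g (par b h u) * (ndesc b h u \in r)%:R)
    <= (size r)%:R * (avg u g * u%:R / n%:R).
Proof.
move=> g0 u0 un; apply: (@le_trans _ _ (mean (fun h : history n =>
    \sum_(k <- r) g (par b h u) * (ndesc b h u == k)%:R))).
  apply: mean_le => // h; rewrite -mulr_sumr ler_wpM2l // -natr_sum ler_nat.
  move: (ndesc b h u) => x.
  elim: r => [|k r IH]; rewrite ?big_nil // big_cons inE; case: (x == k) => //=.
rewrite mean_sum; apply: (@le_trans _ _ (\sum_(k <- r) avg u g * u%:R / n%:R)).
  by apply: ler_sum => k _; exact: mean_ndesc_eq.
by rewrite big_const_seq count_predT iter_addr_0 mulr_natl.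
Qed.

Lemma divn_le n t : (0 < t <= n)%N -> (n %/ t).+1%:R / n%:R <= 2 / t%:R :> R.
Proof.
move=> /andP[t0 tn]; have n0 := leq_trans t0 tn.
rewrite ler_pdivrMr ?ltr0n // mulrAC ler_pdivlMr ?ltr0n // -!natrM ler_nat.
have := leq_divM n t; lia.
Qed.

(** At most [n %/ t + 1] sizes are that small, and [mean_ndesc_eq] bounds the mass of each. *)
Lemma low_tail b g u n t : (forall i, 0 <= g i) -> (0 < u)%N -> (u <= n)%N -> (0 < t <= n)%N ->
  mean (fun h : history n => g (par b h u) * (ndesc b h u * t <= n)%N%:R) <= avg u g * u%:R * 2 / t%:R.
Proof.
move=> g0 u0 un /andP[t0 tn]; have n0 := leq_trans t0 tn.
apply: (@le_trans _ _ (mean (fun h : history n => g (par b h u) * (ndesc b h u \in iota 0 (n %/ t).+1)%:R))).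
  apply: mean_le => // h; rewrite ler_wpM2l // ler_nat mem_iota /= add0n ltnS.
  by rewrite leq_divRL.
apply: (le_trans (mean_ndesc_seq _ _ g0 u0 un)); rewrite size_iota.
have A0 : 0 <= avg u g by rewrite mulr_ge0 ?invr_ge0 // sumr_ge0.
move: (avg u g) A0 => A A0; rewrite [leLHS]mulrCA -[leRHS]mulrA ler_wpM2l ?mulr_ge0 //.
by apply: divn_le; rewrite t0.
Qed.

(** A small complement again allows only [n %/ t + 1] sizes of the subtree of node 1, each of
    probability at most [1 / n]. *)
Lemma high_low_tail b n t : (0 < t <= n)%N ->
  Pr (fun h : history n => ((n.+1 - ndesc b h 1) * t <= n)%N) <= 2 / t%:R.
Proof.
move=> /andP[t0 tn]; have n0 := leq_trans t0 tn.
apply: (@le_trans _ _ (mean (fun h : history n => (fun=> 1) (par b h 1) *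
    (ndesc b h 1 \in [seq n.+1 - i | i <- iota 0 (n %/ t).+1]%N)%:R))).
  apply: mean_le => // h; rewrite mul1r ler_nat; case: (boolP ((n.+1 - ndesc b h 1) * t <= n)%N) => [le|_]; last by [].
rewrite (_ : (_ \in _) = true) //; apply/mapP; exists (n.+1 - ndesc b h 1)%N.
    by rewrite mem_iota /= add0n ltnS leq_divRL.
  by rewrite subKn // ltnW // ltnS ndesc_le.
apply: (le_trans (mean_ndesc_seq b _ (g := fun=> 1) (fun=> ler01) (isT : 0 < 1)%N n0)).
rewrite size_map size_iota /avg big_ord1 !invr1 !mul1r.
by apply: divn_le; rewrite t0.
Qed.

(** Markov's inequality for [D (D + 1)], where [D] is the subtree size. The 4 combines the 2 of
    [mean_ndesc2] with the bound 2 for [(n + 2) / (n + 1)]. *)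
Lemma high_tail b g u n t : (forall i, 0 <= g i) -> (0 < u)%N -> (u <= n)%N ->
  mean (fun h : history n => g (par b h u) * (n < ndesc b h u * t)%N%:R)
    <= avg u g * (4 * t%:R ^+ 2) / (u.+1%:R * u.+2%:R).
Proof.
move=> g0 u0 un.
have N0 : 0 < n.+1%:R :> R by rewrite ltr0n.
apply: (@le_trans _ _ (mean (fun h : history n =>
    (t%:R ^+ 2 / n.+1%:R ^+ 2) * (g (par b h u) * ((ndesc b h u)%:R * (ndesc b h u).+1%:R))))).
  apply: mean_le => // h; rewrite mulrCA ler_wpM2l //.
  case: leqP => [_|lt] /=; first by rewrite !mulr_ge0 ?invr_ge0 ?exprn_ge0.
  rewrite mulrAC ler_pdivlMr ?exprn_gt0 // mul1r -!natrX -!natrM ler_nat.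
  by nia.
rewrite meanZ mean_ndesc2 //.
have A0 : 0 <= avg u g by rewrite mulr_ge0 ?invr_ge0 // sumr_ge0.
have U0 : 0 <= (u.+1%:R * u.+2%:R)^-1 :> R by rewrite invr_ge0 mulr_ge0.
move: (avg u g) A0 => A A0; rewrite !mulrA ler_wpM2r //.
have e : n.+2%:R / n.+1%:R <= 2 :> R by rewrite ler_pdivrMr // -natrM ler_nat; lia.
rewrite (_ : _ * n.+2%:R = (A * t%:R ^+ 2 * 2) * (n.+2%:R / n.+1%:R)); last first.
  by move: n.+1%:R N0 => a a0; field; rewrite gt_eqF.
rewrite [leRHS](_ : _ = (A * t%:R ^+ 2 * 2) * 2); last by ring.
by rewrite ler_wpM2l // !mulr_ge0 // exprn_ge0.
Qed.

(* The children of [v] on the wrong side of the size threshold of [ncut], and 1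
   for the cut at [v] towards its parent. *)
Definition err (b : bool) (t v n : nat) (h : history n) : R :=
  1 + \sum_(0 <= j < t) (par b h j.+1 == v)%:R * (ndesc b h j.+1 * t <= n)%N%:R
    + \sum_(t <= j < n) (par b h j.+1 == v)%:R * (n < ndesc b h j.+1 * t)%N%:R.

Lemma avg_delta_le u v : (0 < u)%N -> avg u (fun i => (i == v)%:R) <= u%:R^-1 :> R.
Proof.
case: u => // u _; rewrite /avg -[leRHS]mulr1 ler_wpM2l ?invr_ge0 //.
have [vu|vu] := leqP v u; first by rewrite sum_eq_nat.
rewrite big1 // => i _; case: eqP => // e.
by have := ltn_ord i; rewrite e ltnNge vu.
Qed.

Lemma sum_inv2 s t : (s <= t)%N ->
  \sum_(s <= j < t) (j.+2%:R * j.+3%:R)^-1 <= s.+2%:R^-1 :> R.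
Proof.
move=> st; rewrite (_ : \sum_(s <= j < t) _ = s.+2%:R^-1 - t.+2%:R^-1) ?lerBlDr ?lerDl ?invr_ge0 //.
elim: t st => [|t IH]; first by rewrite leqn0 => /eqP->; rewrite big_geq // subrr.
rewrite leq_eqVlt => /orP[/eqP<-|st]; first by rewrite big_geq // subrr.
rewrite ltnS in st; rewrite big_nat_recr //= IH //.
by field; have := ler0n R s; have := ler0n R t => *; rewrite !lt0r_neq0 //; lra.
Qed.

(** Here [7 = 1 + 2 + 4]. An early label [j] is a child of [v] with probability at most [1 / j] and
    then has a small subtree with probability at most [2 j / t], so each of the [t] early labels
    costs at most [2 / t]. The late labels cost at most [4 t] times a telescoping sum below
    [1 / t]. *)
Lemma mean_err b t v n : (0 < t <= n)%N -> mean (err b t v (n:=n)) <= 7.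
Proof.
move=> /andP[t0 tn]; rewrite /err !meanD mean_cst !mean_sum.
have g0 i : 0 <= (i == v)%:R :> R by [].
have t0R : 0 < t%:R :> R by rewrite ltr0n.
have le1 : \sum_(0 <= j < t) mean (fun h : history n =>
    (par b h j.+1 == v)%:R * (ndesc b h j.+1 * t <= n)%N%:R) <= 2.
  rewrite big_nat; apply: (@le_trans _ _ (\sum_(0 <= j < t | (0 <= j < t)%N) 2 / t%:R)).
    apply: ler_sum => j /andP[_ jt]; have jn := leq_trans jt tn.
    have t0n : (0 < t <= n)%N by rewrite t0.
    apply: (le_trans (low_tail b g0 (ltn0Sn j) jn t0n)).
    rewrite ler_wpM2r ?invr_ge0 // -[leRHS]mul1r ler_wpM2r //.
    have j0 : 0 < j.+1%:R :> R by rewrite ltr0n.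
    by rewrite -ler_pdivlMr // mul1r avg_delta_le.
  by rewrite -big_nat sumr_const_nat subn0 -(mulr_natr (2 / t%:R)) divfK // gt_eqF.
have le2 : \sum_(t <= j < n) mean (fun h : history n =>
    (par b h j.+1 == v)%:R * (n < ndesc b h j.+1 * t)%N%:R) <= 4.
  rewrite big_nat; apply: (@le_trans _ _ (\sum_(t <= j < n | (t <= j < n)%N)
      4 * t%:R * (j.+2%:R * j.+3%:R)^-1)).
    apply: ler_sum => j /andP[tj jn]; apply: (le_trans (high_tail b t g0 (ltn0Sn j) jn)).
    rewrite ler_wpM2r ?invr_ge0 ?mulr_ge0 // -ler_pdivlMr; last by rewrite mulr_gt0 ?exprn_gt0.
    apply: (le_trans (avg_delta_le v (ltn0Sn j))).
    rewrite (_ : _ / _ = t%:R^-1); last by field; rewrite gt_eqF.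
    by rewrite lef_pV2 ?posrE ?ltr0n // ler_nat ltnW.
  rewrite -big_nat -mulr_sumr; apply: (@le_trans _ _ (4 * t%:R * t.+2%:R^-1)).
    by rewrite ler_wpM2l ?sum_inv2 // mulr_ge0.
  by rewrite ler_pdivrMr ?ltr0n // ler_wpM2l // ler_nat ltnW.
by lra.
Qed.

Lemma err_ge0 b t v n (h : history n) : 0 <= err b t v h.
Proof. by rewrite !addr_ge0 // sumr_ge0 // => j _; rewrite mulr_ge0. Qed.

Lemma ncut_err b t n (h : history n) (v : 'I_n.+1) : (t <= n)%N ->
  `|(ncut (tree b h) t v)%:R - \sum_(0 <= j < t) (par b h j.+1 == v)%:R| <= err b t v h.
Proof.
move=> tn; have := ncut_bounds b h t v; cbv zeta; set U := [set u | _] => /andP[lo hi].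
have eU : #|U|%:R = \sum_(0 <= j < n) (par b h j.+1 == v)%:R * (n < ndesc b h j.+1 * t)%N%:R :> R.
  rewrite -sum1_card natr_sum big_mkcond big_ord_recl inE /= add0r big_mkord.
  by apply: eq_bigr => i _; rewrite inE /=; case: (_ == _); case: (_ < _)%N; rewrite /= ?mulr1 ?mulr0.
have e : #|U|%:R - \sum_(0 <= j < t) (par b h j.+1 == v)%:R =
    \sum_(t <= j < n) (par b h j.+1 == v)%:R * (n < ndesc b h j.+1 * t)%N%:R
   - \sum_(0 <= j < t) (par b h j.+1 == v)%:R * (ndesc b h j.+1 * t <= n)%N%:R :> R.
  rewrite eU (big_cat_nat (leq0n t) tn) /= [X in X - _ = _]addrC -!addrA; congr (_ + _).
  rewrite -sumrB -sumrN; apply: eq_bigr => j _.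
  by case: (leqP (ndesc b h j.+1 * t) n); case: (_ == _) => _; rewrite /=; ring.
have lo' : #|U|%:R <= (ncut (tree b h) t v)%:R :> R by rewrite ler_nat.
have hi' : (ncut (tree b h) t v)%:R <= #|U|%:R + 1 :> R by rewrite natr1 ler_nat.
move: e lo' hi'; rewrite /err.
set x1 := \sum_(0 <= j < t) _ * _; set x2 := \sum_(t <= j < n) _.
set x3 := \sum_(0 <= j < t) _.
have : 0 <= x1 by apply: sumr_ge0 => j _; rewrite mulr_ge0.
have : 0 <= x2 by apply: sumr_ge0 => j _; rewrite mulr_ge0.
by rewrite ler_norml; move: x1 x2 x3 #|U|%:R (ncut _ _ _)%:R => x1 x2 x3 x4 x5 *; lra.
Qed.

Lemma cdegE b s t v n (h : history n) : (s <= t)%N ->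
  cdeg R b s t v h = \sum_(0 <= j < t) (par b h j.+1 == v)%:R
                - \sum_(0 <= j < s) (par b h j.+1 == v)%:R - harm R s t.
Proof.
by move=> st; rewrite /cdeg sumrB (big_cat_nat (leq0n s) st) /= [X in _ = X - _ - _]addrC addrK.
Qed.

Lemma ncut_cdeg b s t n (h : history n) (v : 'I_n.+1) : (s <= t <= n)%N ->
  `|(ncut (tree b h) t v)%:R - (ncut (tree b h) s v)%:R - harm R s t - cdeg R b s t v h|
    <= err b s v h + err b t v h.
Proof.
move=> /andP[st tn]; rewrite cdegE //.
have := ncut_err b h v tn; have := ncut_err b h v (leq_trans st tn).
rewrite !ler_norml; move: (err _ _ _ _) (err _ _ _ _) (\sum_(_ <= _ < _) _) (\sum_(_ <= _ < _) _) => *; lra.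
Qed.

Lemma harm_ge0 s t : 0 <= harm R s t.
Proof. by apply: sumr_ge0 => j _; rewrite invr_ge0. Qed.

(** The correction [alpha / (j + 1)^2] is at most [1 / (s + 1)] times [1 / (j + 1)], so late windows
    have almost no bias. *)
Lemma xcov_bounds s t v v' : let c := alpha * (v == v')%:R in
  c * harm R s t - s.+1%:R^-1 * harm R s t <= xcov alpha s t v v' <= c * harm R s t.
Proof.
cbv zeta; case/andP: alpha01 => a0 a1.
rewrite -mulrBl /harm !mulr_sumr /xcov; apply/andP; split.
  rewrite big_nat [leRHS]big_nat; apply: ler_sum => j /andP[sj _].
  rewrite mulrBl lerD2l lerN2.
  have j0 : 0 <= j.+1%:R^-1 :> R by rewrite invr_ge0.
  have js : j.+1%:R^-1 <= s.+1%:R^-1 :> R by rewrite lef_pV2 ?posrE ?ltr0n // ler_nat.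
  by rewrite -exprVn expr2 -[leRHS]mul1r ler_pM ?mulr_ge0 ?ler_wpM2r.
apply: ler_sum => j _; rewrite lerBlDr lerDl mulr_ge0 // invr_ge0 exprn_ge0 //.
Qed.

End Tails.

(** * Correlation of the window counts *)

Section Windows.
Local Open Scope ring_scope.
Variables (R : realFieldType) (alpha : R).
Hypothesis alpha01 : 0 <= alpha <= 1.
Local Notation mean := (mean alpha).
Local Notation cdeg := (cdeg R).
Local Notation harm := (harm R).

Variables (W : nat) (t : nat -> nat).
Hypothesis t_incr : forall w, (t w <= t w.+1)%N.
Hypothesis H1 : forall w, 1 <= harm (t w) (t w.+1).
Hypothesis W_le : (W <= t 0)%N.

Let t_mono : {homo t : i j / (i <= j)%N} := homo_leq leqnn leq_trans t_incr.

Section Pair.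
Variables (v v' : nat).
Hypotheses (vt : (v <= t 0)%N) (vt' : (v' <= t 0)%N).
Let c : R := alpha * (v == v')%:R.

Definition dev (w n : nat) (h : history n) : R :=
  cdeg true (t w) (t w.+1) v h * cdeg false (t w) (t w.+1) v' h / harm (t w) (t w.+1)
  - alpha * (v == v')%:R.

Definition devs (m n : nat) (h : history n) : R := \sum_(0 <= w < m) dev w h.

Lemma dev_frozen w : frozen (t w.+1) (dev w).
Proof. by move=> n h tn; rewrite /dev !cdeg_frozen. Qed.

Lemma devs_frozen m : frozen (t m) (devs m).
Proof.
move=> n h tn; rewrite /devs big_nat [RHS]big_nat; apply: eq_bigr => w /andP[_ wm].
by apply: dev_frozen; apply: leq_trans tn; apply: t_mono.
Qed.

Let th : R := (t 0).+1%:R^-1.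

(** The conditional mean of [dev m] given the first [t m] steps is a constant [d], the small bias
    found in [xcov_bounds]. *)
Lemma mean_mul_dev F m : frozen (t m) F -> exists2 d : R, - th <= d <= 0 &
  mean (fun h : history (t m.+1) => F _ h * dev m h) = d * mean (F (t m)).
Proof.
move=> fr; have h0 : 0 < harm (t m) (t m.+1) by apply: lt_le_trans (H1 m).
exists (xcov alpha (t m) (t m.+1) v v' / harm (t m) (t m.+1) - c).
  have /andP[lo hi] := xcov_bounds alpha01 (t m) (t m.+1) v v'.
  apply/andP; split; last by rewrite subr_le0 ler_pdivrMr.
  have le : - th <= - (t m).+1%:R^-1 by rewrite lerN2 lef_pV2 ?posrE ?ltr0n // ler_nat ltnS t_mono.
  by apply: (le_trans le); rewrite lerBrDl ler_pdivlMr // mulrDl mulNr.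
have e0 : (t 0 <= t m)%N by apply: t_mono.
rewrite (@mean_eq _ _ _ _ (fun h : history (t m.+1) => (harm (t m) (t m.+1))^-1 *
    (F _ h * (cdeg true (t m) (t m.+1) v h * cdeg false (t m) (t m.+1) v' h)) + (- c) * F _ h)); last first.
  by move=> h; rewrite /dev -/c; ring.
rewrite meanD !meanZ mean_cdeg_mul ?(leq_trans vt) ?(leq_trans vt') // (mean_frozen alpha fr) //.
by rewrite mulrA [_^-1 * _]mulrC -mulrDl.
Qed.

Lemma mean_devs m : - (m%:R * th) <= mean (fun h : history (t m) => devs m h) <= 0.
Proof.
elim: m => [|m /andP[lo hi]].
  by rewrite mul0r oppr0 (@mean_eq _ _ _ _ (fun=> 0)) ?mean_cst ?lexx // => h; rewrite /devs big_geq.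
have [d /andP[d1 d2] e] := @mean_mul_dev (fun _ _ => 1) m (fun _ _ _ => erefl).
rewrite (@mean_eq _ _ _ _ (fun h : history (t m.+1) => devs m h + 1 * dev m h)); last first.
  by move=> h; rewrite mul1r /devs big_nat_recr.
rewrite meanD e mean_cst mulr1 (mean_frozen alpha (@devs_frozen m)) //.
by rewrite -natr1 mulrDl mul1r; apply/andP; split; lra.
Qed.

(** Here [10 = 8 + 2]: each fourth moment is at most [3 HH^2 + HH <= 4 HH^2] since [HH >= 1], and
    the centering contributes at most [2 c^2 <= 2]. *)
Lemma mean_dev2 m : mean (fun h : history (t m.+1) => dev m h ^+ 2) <= 10.
Proof.
have h1 := H1 m; set HH := harm (t m) (t m.+1) in h1.
have h0 : 0 < HH by apply: lt_le_trans h1.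
have e0 : (t 0 <= t m)%N by apply: t_mono.
have c1 : c ^+ 2 <= 1.
  case/andP: alpha01 => a0 a1.
  by rewrite /c; case: (_ == _); rewrite ?mulr1 ?mulr0 ?expr0n //= expr_le1.
apply: (@le_trans _ _ (mean (fun h : history (t m.+1) => HH ^- 2 *
   (cdeg true (t m) (t m.+1) v h ^+ 4 + cdeg false (t m) (t m.+1) v' h ^+ 4) + 2))).
  apply: mean_le => // h; rewrite /dev -/c -/HH.
  move: (cdeg _ _ _ _ _) (cdeg _ _ _ _ _) => x y.
  rewrite -exprVn; set i := HH^-1.
  have : (x * y * i - c) ^+ 2 <= 2 * (x * y * i) ^+ 2 + 2 * c ^+ 2.
    have := sqr_ge0 (x * y * i + c); nra.
  have : 2 * (x * y * i) ^+ 2 <= i ^+ 2 * (x ^+ 4 + y ^+ 4).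
    have := sqr_ge0 (i * (x ^+ 2 - y ^+ 2)); nra.
  lra.
rewrite meanD mean_cst meanZ meanD.
have x4 := mean_cdeg4 alpha01 true (leq_trans vt e0) (t_incr m).
have y4 := mean_cdeg4 alpha01 false (leq_trans vt' e0) (t_incr m).
have : HH ^- 2 * (mean (fun h : history (t m.+1) => cdeg true (t m) (t m.+1) v h ^+ 4) +
   mean (fun h : history (t m.+1) => cdeg false (t m) (t m.+1) v' h ^+ 4)) <= 8.
  rewrite mulrC ler_pdivrMr ?exprn_gt0 //.
  have : HH <= HH ^+ 2 by rewrite expr2 ler_pMr.
  move: x4 y4; rewrite -/HH; lra.
lra.
Qed.

(** The windows are nearly orthogonal: the cross term is [2 d a] with [a] the accumulated bias, and
    [|a| <= m / (t 0 + 1) <= 1] because [W <= t 0]. Each window thus adds at most [10 + 2]. *)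
Lemma mean_devs2 m : (m <= W)%N -> mean (fun h : history (t m) => devs m h ^+ 2) <= 12 * m%:R.
Proof.
elim: m => [_|m IH mW].
  by rewrite mulr0 (@mean_eq _ _ _ _ (fun=> 0)) ?mean_cst ?lexx // => h; rewrite /devs big_geq ?expr0n.
have [d /andP[d1 d2] e] := @mean_mul_dev (devs m) m (@devs_frozen m).
rewrite (@mean_eq _ _ _ _ (fun h : history (t m.+1) => devs m h ^+ 2 +
    (2 * (devs m h * dev m h) + dev m h ^+ 2))); last first.
  by move=> h; rewrite /devs big_nat_recr //=; ring.
rewrite !meanD meanZ e.
have fr2 : frozen (t m) (fun n (h : history n) => devs m h ^+ 2).
  by move=> n h tn; rewrite devs_frozen.
rewrite (mean_frozen alpha fr2) //.
have := mean_dev2 m; have := IH (ltnW mW); have /andP[] := mean_devs m.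
have th0 : 0 <= th by rewrite invr_ge0.
have th1 : m%:R * th <= 1.
  rewrite ler_pdivrMr ?ltr0n // mul1r ler_nat; apply: ltnW; apply: leq_trans mW _.
  exact: leq_trans W_le _.
have th2 : th <= 1 by rewrite invf_le1 ?ltr0n // ler1n.
rewrite -[m.+1%:R]natr1 mulrDr mulr1.
set a := mean (fun h => devs m h); set x := mean _; set y := mean _ => lo hi ih d10.
have : d * a <= 1 by nra.
lra.
Qed.


End Pair.
End Windows.

(** * The estimator *)

Section Estimator.
Local Open Scope ring_scope.
Variables (R : realFieldType).
Local Notation harm := (harm R).

Lemma harm_cat s m t : (s <= m <= t)%N -> harm s t = harm s m + harm m t.
Proof. by case/andP => sm mt; rewrite /harm (big_cat_nat sm mt). Qed.

Lemma harm_double m : (0 < m)%N -> 2^-1 <= harm m (m * 2)%N.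
Proof.
move=> m0; have m0R : 0 < m%:R :> R by rewrite ltr0n.
apply: (@le_trans _ _ (\sum_(m <= j < m * 2) (m * 2)%:R^-1)).
  rewrite sumr_const_nat (_ : m * 2 - m = m)%N; last by lia.
  rewrite -[leRHS]mulr_natr natrM invfM mulrAC mulVf ?mul1r // gt_eqF //.
rewrite /harm big_nat [leRHS]big_nat; apply: ler_sum => j /andP[_ jm].
by rewrite lef_pV2 ?posrE ?ltr0n ?ler_nat //; lia.
Qed.

(** Each doubling of the endpoint adds at least one half, so one unit costs two doublings. *)
Lemma harm_pow s i : (0 < s)%N -> i%:R <= harm s (s * 2 ^ (i * 2))%N.
Proof.
move=> s0; elim: i => [|i IH]; first exact: harm_ge0.
have p m : (0 < s * 2 ^ m)%N by rewrite muln_gt0 s0 expn_gt0.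
have e : (s * 2 ^ (i.+1 * 2) = s * 2 ^ (i * 2) * 2 * 2)%N.
  by rewrite mulSn addnC !expnD -!mulnA.
rewrite (@harm_cat s (s * 2 ^ (i * 2))%N); last first.
  by rewrite e -{1}(muln1 s) leq_mul2l expn_gt0 orbT /=; lia.
rewrite e (@harm_cat (s * 2 ^ (i * 2)) (s * 2 ^ (i * 2) * 2)%N); last by lia.
have := harm_double (p (i * 2)%N).
have p2 : (0 < s * 2 ^ (i * 2) * 2)%N by have := p (i * 2)%N; lia.
have := harm_double p2.
by rewrite -[i.+1%:R]natr1; lra.
Qed.

Definition wcount (n : nat) (E : lgraph n) (s t : nat) (v : 'I_n.+1) : R :=
  (ncut E t v)%:R - (ncut E s v)%:R - harm s t.

Definition corr (n W : nat) (t : nat -> nat) (E E' : lgraph n) (v v' : 'I_n.+1) : R :=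
  W%:R^-1 * \sum_(0 <= w < W)
    wcount E (t w) (t w.+1) v * wcount E' (t w) (t w.+1) v' / harm (t w) (t w.+1).

(* Node 0 of a representative can be any node of the unlabeled tree, so this
   maximizes over all pairs of balanced nodes. *)
Definition estimator (n k W : nat) (t : nat -> nat) (x y : ugraph n) : R :=
  \big[Num.max/0]_(e : lgraph n * lgraph n |
      [&& unlabel e.1 == x, unlabel e.2 == y, balanced e.1 k ord0 & balanced e.2 k ord0])
    corr W t e.1 e.2 ord0 ord0.

Lemma unlabel_eqP n (E F : lgraph n) :
  reflect (exists s, E = relabel s F) (unlabel E == unlabel F).
Proof.
apply: (iffP idP).
  move/eqP => /eqmodP; rewrite /= isograph_sym => /existsP[s /eqP e]; by exists s.
by move=> [s e]; apply/eqP/eqmodP; rewrite /= isograph_sym; apply/existsP; exists s; apply/eqP.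
Qed.

(** The pair of true nodes 0 is a candidate, which gives the lower bound. Every other candidate
    corresponds to labels at most [r], where the correlation is near [a] or near 0, hence at most
    [a + eps]. *)
Lemma estimator_close n k W t (x y : ugraph n) (E F : lgraph n) (a eps : R) (r : nat) :
  0 <= a -> 0 < eps ->
  x = unlabel E -> y = unlabel F ->
  balanced E k ord0 -> balanced F k ord0 ->
  (forall v, balanced E k v -> (v <= r)%N) -> (forall v, balanced F k v -> (v <= r)%N) ->
  (forall v v' : 'I_n.+1, (v <= r)%N -> (v' <= r)%N ->
     `|corr W t E F v v' - a * (v == v' :> nat)%:R| <= eps) ->
  `|estimator k W t x y - a| <= eps.
Proof.
move=> a0 e0 -> -> bE bF lE lF cor; rewrite ler_distl; apply/andP; split.
  apply: (@le_trans _ _ (corr W t E F ord0 ord0)).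
    by have := cor ord0 ord0 isT isT; rewrite eqxx mulr1 ler_distl => /andP[].
  have PEF : [&& unlabel E == unlabel E, unlabel F == unlabel F, balanced E k ord0 & balanced F k ord0].
    by rewrite !eqxx bE bF.
  exact: (@le_bigmax_cond _ _ _ 0 (E, F) _ (fun e => corr W t e.1 e.2 ord0 ord0) PEF).
(* The default value 0 of the maximum is harmless since [0 <= a]. *)
apply: bigmax_le; first by lra.
move=> [E' F'] /= /and4P[/unlabel_eqP[s ->] /unlabel_eqP[s' ->]].
rewrite -[X in balanced _ _ X](permKV s) balanced_relabel => /lE vr.
rewrite -[X in balanced _ _ X](permKV s') balanced_relabel => /lF vr'.
have -> : corr W t (relabel s E) (relabel s' F) ord0 ord0 =
    corr W t E F (s^-1%g ord0) (s'^-1%g ord0).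
  rewrite /corr; congr (_ * _); apply: eq_bigr => w _; rewrite /wcount.
  have e (p : {perm 'I_n.+1}) G i : ncut (relabel p G) i ord0 = ncut G i (p^-1%g ord0).
    by rewrite -[in LHS](permKV p ord0) ncut_relabel.
  by rewrite !e.
have := cor _ _ vr vr'; rewrite ler_distl => /andP[_ le]; apply: (le_trans le).
by rewrite lerD2r ler_piMr //; case: (_ == _).
Qed.

Lemma balanced0 b n k (h : history n) : (0 < n)%N ->
  (n < ndesc b h 1 * k)%N -> (n < (n.+1 - ndesc b h 1) * k)%N -> balanced (tree b h) k ord0.
Proof.
move=> n0 h1 h2; apply/existsP; exists (descs b h 1); rewrite h1 /=; apply/andP; split.
  apply/cut_atP; left; exists (inord 1); rewrite inordK //; split=> //.
  by have := par_lt b h (isT : 0 < 1)%N; case: (par _ _ _).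
have := cardsC (descs b h 1); rewrite card_ord -/(ndesc b h 1) => e.
by have <- : (n.+1 - ndesc b h 1 = #|~: descs b h 1|)%N by lia.
Qed.

(** Towards a child or towards the parent, a cut at a label above [r] has the subtree of a label
    above [r] on one side, which is too small. *)
Lemma balanced_le b n k r (h : history n) (v : 'I_n.+1) :
  (forall j, (r <= j < n)%N -> (ndesc b h j.+1 * k <= n)%N) -> balanced (tree b h) k v -> (v <= r)%N.
Proof.
move=> le /existsP[S /and3P[/cut_atP[[u u0 [pu ->]]|[v0 ->]] c1 c2]]; rewrite leqNgt; apply/negP => rv.
  have := par_lt b h u0; rewrite pu => vu; have := ltn_ord u => un.
  have /le : (r <= u.-1 < n)%N by lia.
  by rewrite prednK // leqNgt => /negP; apply; exact: c1.
have := ltn_ord v => vn; rewrite setCK in c2.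
have /le : (r <= v.-1 < n)%N by lia.
by rewrite prednK // leqNgt => /negP; apply; exact: c2.
Qed.

(** The mixed errors [e |x|] are split by the inequality of arithmetic and geometric means with
    weight [l]. A small [l] makes the term in [h] a small fraction of [h], and the other terms do
    not grow with [h]. *)
Lemma prod_close (x1 x2 y1 y2 e l Q h : R) : 0 < l -> 0 <= e ->
  `|y1 - x1| <= e -> `|y2 - x2| <= e -> x1 ^+ 2 <= Q * h -> x2 ^+ 2 <= Q * h ->
  `|y1 * y2 - x1 * x2| <= 2 * l * Q * h + e ^+ 2 / (2 * l) + e ^+ 2.
Proof.
move=> l0 e0 d1 d2 q1 q2.
have amgm x : e * `|x| <= l * x ^+ 2 + e ^+ 2 / (4 * l).
  rewrite -(real_normK (num_real x)); set z := `|x|.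
  rewrite -subr_ge0.
  have -> : l * z ^+ 2 + e ^+ 2 / (4 * l) - e * z = (2 * l * z - e) ^+ 2 / (4 * l).
    by field; rewrite gt_eqF.
  by rewrite mulr_ge0 ?sqr_ge0 // invr_ge0 mulr_ge0 // ltW.
have -> : y1 * y2 - x1 * x2 = (y1 - x1) * x2 + (y2 - x2) * x1 + (y1 - x1) * (y2 - x2) by ring.
apply: (@le_trans _ _ (e * `|x2| + e * `|x1| + e * e)).
  apply: (le_trans (ler_normD _ _)); apply: lerD; last by rewrite normrM ler_pM.
  by apply: (le_trans (ler_normD _ _)); rewrite !normrM; apply: lerD; rewrite ler_wpM2r.
have := amgm x1; have := amgm x2.
have -> : e ^+ 2 / (2 * l) = e ^+ 2 / (4 * l) + e ^+ 2 / (4 * l) by field; rewrite gt_eqF.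
by set z := e ^+ 2 / _; nra.
Qed.

End Estimator.

(** * Exceptional events and their probabilities *)

Section Bad.
Local Open Scope ring_scope.
Variables (R : realFieldType) (alpha : R).
Hypothesis alpha01 : 0 <= alpha <= 1.
Local Notation Pr := (Pr alpha).
Local Notation cdeg := (cdeg R).
Local Notation harm := (harm R).
Variables (n k r W : nat) (t : nat -> nat) (M Q L eta : R).
Hypotheses (k0 : (0 < k)%N) (W0 : (0 < W)%N) (M0 : 0 < M) (Q0 : 0 < Q) (eta0 : 0 < eta).
Hypothesis t_incr : forall w, (t w <= t w.+1)%N.
Hypothesis L1 : 1 <= L.
Hypothesis HL : forall w, L <= harm (t w) (t w.+1).
Hypotheses (W_le : (W <= t 0)%N) (r_le : (r <= t 0)%N) (k_le : (k <= n)%N) (tW : (t W <= n)%N).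

Let t_mono : {homo t : i j / (i <= j)%N} := homo_leq leqnn leq_trans t_incr.
Let H1 w : 1 <= harm (t w) (t w.+1) := le_trans L1 (HL w).
Let H0 w : 0 < harm (t w) (t w.+1) := lt_le_trans ltr01 (H1 w).

(* Outside of [bad1] and [bad2] the balanced nodes include 0 and have label at
   most [r]; outside of [bad3] and [bad4] the counts read off from the unlabeled
   trees are close enough to the true ones, whose empirical correlations are
   controlled outside of [bad5]. *)
Definition bad1 (h : history n) : bool :=
  [exists b, (ndesc b h 1 * k <= n)%N || ((n.+1 - ndesc b h 1) * k <= n)%N].
Definition bad2 (h : history n) : bool :=
  [exists b, has (fun j => (n < ndesc b h j.+1 * k)%N) (index_iota r n)].
Definition bad3 (h : history n) : bool :=
  [exists i : bool * 'I_r.+1 * 'I_W.+1, M < err R i.1.1 (t i.2) i.1.2 h].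
Definition bad4 (h : history n) : bool :=
  [exists i : bool * 'I_r.+1 * 'I_W,
     Q < cdeg i.1.1 (t i.2) (t i.2.+1) i.1.2 h ^+ 2 / harm (t i.2) (t i.2.+1)].
Definition bad5 (h : history n) : bool :=
  [exists i : 'I_r.+1 * 'I_r.+1, eta < `|devs alpha t i.1 i.2 W h / W%:R|].
Definition bad (h : history n) : bool :=
  [|| bad1 h, bad2 h, bad3 h, bad4 h | bad5 h].

Lemma Pr_has m (A : nat -> pred (history m)) (s : seq nat) :
  Pr (fun h => has (fun j => A j h) s) <= \sum_(j <- s) Pr (A j).
Proof.
elim: s => [|j s IH]; first by rewrite big_nil /Pr mean_cst.
by rewrite big_cons; apply: le_trans (Pr_or _ _ _) _ => //; rewrite lerD2l.
Qed.

(** The 8 counts two trees, two sides of the edge and the constant 2 of each tail. *)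
Lemma Pr_bad1 : Pr bad1 <= 8 / k%:R.
Proof.
have kn : (0 < k <= n)%N by rewrite k0.
have n0 : (0 < n)%N by apply: leq_trans k_le.
apply: (@le_trans _ _ (#|{: bool}|%:R * (4 / k%:R))); last by rewrite card_bool mulrA -natrM.
apply: (@Pr_exists _ _ alpha01 n _ (fun b h => (ndesc b h 1 * k <= n)%N || ((n.+1 - ndesc b h 1) * k <= n)%N)) => b.
apply: le_trans (Pr_or _ _ _) _ => //.
rewrite (_ : 4 / k%:R = 2 / k%:R + 2 / k%:R); last by rewrite -mulrDl -natrD.
apply: lerD; last exact: high_low_tail.
have := low_tail alpha01 b (g := fun=> 1) (fun=> ler01) (isT : 0 < 1)%N n0 kn.
rewrite /avg big_ord1 invr1 !mul1r; apply: le_trans.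
by apply: mean_le => // h; rewrite mul1r.
Qed.

Lemma Pr_bad2 : Pr bad2 <= 8 * k%:R ^+ 2 / r.+2%:R.
Proof.
apply: (@le_trans _ _ (#|{: bool}|%:R * (4 * k%:R ^+ 2 / r.+2%:R))); last first.
  by rewrite card_bool !mulrA -natrM.
apply: (@Pr_exists _ _ alpha01 n _ (fun b h => has (fun j => (n < ndesc b h j.+1 * k)%N) (index_iota r n))) => b.
apply: le_trans (Pr_has _ _) _.
have rn : (r <= n)%N by apply: leq_trans r_le _; apply: leq_trans tW; exact: t_mono.
apply: (@le_trans _ _ (\sum_(r <= j < n) 4 * k%:R ^+ 2 * (j.+2%:R * j.+3%:R)^-1)); last first.
  by rewrite -mulr_sumr ler_wpM2l ?sum_inv2 // mulr_ge0 ?exprn_ge0.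
rewrite big_nat [leRHS]big_nat; apply: ler_sum => j /andP[_ jn].
have := high_tail alpha01 b k (g := fun=> 1) (fun=> ler01) (ltn0Sn j) jn.
have -> : avg j.+1 (fun=> 1) = 1 :> R by rewrite /avg sum_cst mulr1 mulVf ?pnatr_eq0.
rewrite mul1r; apply: le_trans.
by apply: mean_le => // h; rewrite mul1r.
Qed.

(** Union bound and Markov's inequality with [mean_err]; the [W] windows have [W.+1] endpoints. *)
Lemma Pr_bad3 : Pr bad3 <= (2 * r.+1 * W.+1)%:R * (7 / M).
Proof.
have -> : (2 * r.+1 * W.+1 = #|{: bool * 'I_r.+1 * 'I_W.+1}|)%N.
  by rewrite !card_prod card_bool !card_ord.
apply: (@Pr_exists _ _ alpha01 n _ (fun (i : bool * 'I_r.+1 * 'I_W.+1) h =>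
   M < err R i.1.1 (t i.2) i.1.2 h)) => -[[b v] w] /=.
apply: le_trans (Pr_markov _ _ _) _ => // [h|]; first exact: err_ge0.
apply: ler_wpM2r; first by rewrite invr_ge0 ltW.
apply: mean_err => //; apply/andP; split.
  by apply: leq_trans W0 _; apply: leq_trans W_le _; apply: t_mono.
by apply: leq_trans tW; apply: t_mono; rewrite -ltnS.
Qed.

Lemma Pr_bad4 : Pr bad4 <= (2 * r.+1 * W)%:R * Q^-1.
Proof.
have -> : (2 * r.+1 * W = #|{: bool * 'I_r.+1 * 'I_W}|)%N.
  by rewrite !card_prod card_bool !card_ord.
apply: (@Pr_exists _ _ alpha01 n _ (fun (i : bool * 'I_r.+1 * 'I_W) h =>
   Q < cdeg i.1.1 (t i.2) (t i.2.+1) i.1.2 h ^+ 2 / harm (t i.2) (t i.2.+1))) => -[[b v] w] /=.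
apply: le_trans (Pr_markov _ _ _) _ => // [h|].
  by rewrite mulr_ge0 ?sqr_ge0 // invr_ge0 ltW.
rewrite -[leRHS]mul1r; apply: ler_wpM2r; first by rewrite invr_ge0 ltW.
rewrite (@mean_eq _ _ _ _ (fun h => (harm (t w) (t w.+1))^-1 * cdeg b (t w) (t w.+1) v h ^+ 2)); last first.
  by move=> h; rewrite mulrC.
rewrite meanZ mulrC ler_pdivrMr // mul1r.
have fr : frozen (t w.+1) (fun m (h : history m) => cdeg b (t w) (t w.+1) v h ^+ 2).
  by move=> m h tm; rewrite cdeg_frozen.
rewrite (mean_frozen alpha fr); last by apply: leq_trans tW; apply: t_mono.
apply: mean_cdeg2 => //; apply: leq_trans (_ : (v <= r)%N) _; first by rewrite -ltnS.
by apply: leq_trans r_le _; apply: t_mono.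
Qed.

(** Chebyshev's inequality: the sum over the windows has second moment at most [12 W], against
    [W^2 eta^2]. *)
Lemma Pr_bad5 : Pr bad5 <= (r.+1 * r.+1)%:R * (12 / (W%:R * eta ^+ 2)).
Proof.
have -> : (r.+1 * r.+1 = #|{: 'I_r.+1 * 'I_r.+1}|)%N by rewrite !card_prod !card_ord.
apply: (@Pr_exists _ _ alpha01 n _ (fun (i : 'I_r.+1 * 'I_r.+1) h =>
   eta < `|devs alpha t i.1 i.2 W h / W%:R|)) => -[v v'] /=.
have W0R : 0 < W%:R :> R by rewrite ltr0n.
apply: (@le_trans _ _ (Pr (fun h : history n => eta ^+ 2 * W%:R ^+ 2 < devs alpha t v v' W h ^+ 2))).
  apply: Pr_le => // h; rewrite normrM normfV (ger0_norm (ltW W0R)) ltr_pdivlMr // => lt.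
  rewrite -exprMn -(real_normK (num_real (devs _ _ _ _ _ _))).
  by rewrite ltr_pXn2r // nnegrE ?normr_ge0 // mulr_ge0 // ltW.
apply: le_trans (Pr_markov _ _ _) _ => // [|h|]; first by rewrite mulr_gt0 ?exprn_gt0.
  exact: sqr_ge0.
have fr : frozen (t W) (fun m (h : history m) => devs alpha t v v' W h ^+ 2).
  by move=> m h tm; rewrite devs_frozen.
rewrite (mean_frozen alpha fr) //.
have vr (u : 'I_r.+1) : (u <= t 0)%N by apply: leq_trans r_le; rewrite -ltnS.
rewrite ler_pdivrMr ?mulr_gt0 ?exprn_gt0 //.
rewrite (_ : 12 / _ * _ = 12 * W%:R); last by field; rewrite !gt_eqF.
exact: (mean_devs2 alpha01 t_incr H1 W_le).
Qed.

(** One [eta] pays for the empirical correlation of the true counts, the other for replacing these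
    by the observed counts. The latter error is bounded relative to the window length, whence the
    lower bound on [L]. *)
Lemma not_bad (h : history n) :
  (4 * M ^+ 2 * (2 * Q / eta) + 4 * M ^+ 2) <= eta / 2 * L -> ~~ bad h ->
  `|estimator R k W t (unlabel (tree1 h)) (unlabel (tree2 h)) - alpha| <= 2 * eta.
Proof.
move=> Lbig; rewrite /bad !negb_or => /and5P[n1 n2 n3 n4 n5].
have n0 : (0 < n)%N by apply: leq_trans k_le.
have bal b : balanced (tree b h) k ord0.
  move: n1; rewrite negb_exists => /forallP/(_ b); rewrite negb_or -!ltnNge => /andP[? ?].
  exact: balanced0.
have bal_le b v : balanced (tree b h) k v -> (v <= r)%N.
  apply: balanced_le => j jn; move: n2; rewrite negb_exists => /forallP/(_ b)/hasPn/(_ j).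
  by rewrite mem_index_iota -leqNgt; apply.
case/andP: (alpha01) => a0 a1.
apply: (@estimator_close _ n k W t _ _ (tree true h) (tree false h) alpha _ r) => //; last first.
- move=> v v' vr vr'.
  have W0R : 0 < W%:R :> R by rewrite ltr0n.
  have vr1 : (v < r.+1)%N by []. have vr1' : (v' < r.+1)%N by [].
  have n5' : `|devs alpha t v v' W h / W%:R| <= eta.
    move: n5; rewrite negb_exists => /forallP/(_ (Ordinal vr1, Ordinal vr1')) /=.
    by rewrite -leNgt.
  set c := alpha * (v == v' :> nat)%:R.
  have -> : corr R W t (tree true h) (tree false h) v v' - c =
     devs alpha t v v' W h / W%:R +
     W%:R^-1 * \sum_(0 <= w < W) ((wcount R (tree true h) (t w) (t w.+1) v * wcount R (tree false h) (t w) (t w.+1) v'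
       - cdeg true (t w) (t w.+1) v h * cdeg false (t w) (t w.+1) v' h) / harm (t w) (t w.+1)).
    rewrite /devs /dev -/c [X in _ = X + _]mulrC -mulrDr -big_split /=.
    rewrite /corr; apply: (@mulfI _ W%:R); rewrite ?gt_eqF //.
    rewrite mulrBr !mulVKf ?gt_eqF //.
    have -> : W%:R * c = \sum_(0 <= w < W) c by rewrite sumr_const_nat subn0 mulr_natl.
    by rewrite -sumrB; apply: eq_bigr => w _; ring.
  apply: (le_trans (ler_normD _ _)); rewrite mulrDl mul1r lerD //.
  rewrite normrM normfV (ger0_norm (ltW W0R)) mulrC ler_pdivrMr // mulrC.
  have -> : W%:R * eta = \sum_(0 <= w < W) eta by rewrite sumr_const_nat subn0 mulr_natl.
  apply: (le_trans (ler_norm_sum _ _ _)); rewrite big_nat [leRHS]big_nat; apply: ler_sum => w /andP[_ wW].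
  rewrite normrM normfV (ger0_norm (ltW (H0 w))) ler_pdivrMr //.
  have err_le b (u : 'I_n.+1) (z : nat) : (u <= r)%N -> (z <= W)%N -> err R b (t z) u h <= M.
    move=> ur zW; have ur1 : (u < r.+1)%N by []. have zW1 : (z < W.+1)%N by [].
    move: n3; rewrite negb_exists => /forallP/(_ (b, Ordinal ur1, Ordinal zW1)) /=.
    by rewrite -leNgt.
  have close b (u : 'I_n.+1) : (u <= r)%N ->
      `|wcount R (tree b h) (t w) (t w.+1) u - cdeg b (t w) (t w.+1) u h| <= 2 * M.
    move=> ur; apply: (le_trans (@ncut_cdeg R b (t w) (t w.+1) n h u _)).
      by rewrite t_incr; apply: leq_trans tW; apply: t_mono.
    by rewrite mulrDl mul1r lerD // err_le // ltnW.
  have x2 b (u : 'I_n.+1) : (u <= r)%N -> cdeg b (t w) (t w.+1) u h ^+ 2 <= Q * harm (t w) (t w.+1).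
    move=> ur; have ur1 : (u < r.+1)%N by [].
    move: n4; rewrite negb_exists => /forallP/(_ (b, Ordinal ur1, Ordinal wW)) /=.
    by rewrite -leNgt ler_pdivrMr.
  (* This weight makes the first term of [prod_close] equal to [eta / 2 * HH]; the other half
     absorbs the constant terms because [HH >= L]. *)
  have l0 : 0 < eta / (4 * Q) by rewrite divr_gt0 // mulr_gt0.
  have M2 : 0 <= 2 * M by rewrite mulr_ge0 // ltW.
  apply: (le_trans (prod_close l0 M2 (close true v vr) (close false v' vr') (x2 true v vr) (x2 false v' vr'))).
  have := HL w; move: (harm (t w) (t w.+1)) => HH LH.
  have -> : 2 * (eta / (4 * Q)) * Q * HH = eta / 2 * HH by field; rewrite gt_eqF.
  have -> : (2 * M) ^+ 2 / (2 * (eta / (4 * Q))) = 4 * M ^+ 2 * (2 * Q / eta) by field; rewrite !gt_eqF.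
  have -> : (2 * M) ^+ 2 = 4 * M ^+ 2 by ring.
  have : eta / 2 * L <= eta / 2 * HH by rewrite ler_wpM2l // divr_ge0 // ltW.
  have -> : eta * HH = eta / 2 * HH + eta / 2 * HH by field.
  by rewrite -addrA; move: Lbig => a b; rewrite lerD2l; apply: le_trans a b.
- exact: bal_le.
- exact: bal_le.
- by rewrite mulr_gt0.
Qed.

End Bad.

(* Choice of the parameters and convergence in probability *)
From mathcomp Require Import all_classical all_reals topology normedtype sequences.
Import numFieldNormedType.Exports.

Local Open Scope classical_set_scope.
Local Open Scope ring_scope.

Lemma exists_nat_ge (R : realType) (x : R) : exists2 m : nat, (0 < m)%N & x <= m%:R.
Proof.
exists (Num.bound `|x|).+1 => //.
apply: le_trans (ler_norm x) _; apply: ltW; apply: lt_le_trans (archi_boundP _) _ => //.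
by rewrite ler_nat.
Qed.

Lemma CUA_Pr (R : realType) (alpha : R) n (A : pred (ugraph n * ugraph n)) :
  CUA alpha A = Pr alpha (fun h : history n => A (unlabel (tree1 h), unlabel (tree2 h))).
Proof.
rewrite /CUA big_mkcond; apply: eq_bigr => h _.
by case: (A _); rewrite ?mulr1 ?mulr0.
Qed.

Lemma uniform_estimator (R : realType) (eps : R) : 0 < eps ->
  exists N : nat, forall n : nat, (N <= n)%N ->
  exists e : ugraph n -> ugraph n -> R, forall alpha : R, 0 <= alpha <= 1 ->
    CUA alpha (fun x : ugraph n * ugraph n => eps < `|e x.1 x.2 - alpha|) <= eps.
Proof.
move=> eps0.
have [eta eta0 etaE] : exists2 eta, 0 < eta & eps = 2 * eta.
  by exists (eps / 2); [rewrite divr_gt0 | field].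
(* The parameters are fixed in the order [k], [r], [W], then [M] and [Q], then [L], each depending
   only on earlier ones and on [eps], never on [alpha]. The constants give each of the five bad
   events probability at most [eps / 5]. *)
have [k k0 kE] := exists_nat_ge (40 / eps).
have [r r0 rE] := exists_nat_ge (40 * k%:R ^+ 2 / eps).
have [W W0 WE] := exists_nat_ge (60 * (r.+1 * r.+1)%:R / (eta ^+ 2 * eps)).
pose M : R := 35 * (2 * r.+1 * W.+1)%:R / eps.
pose Q : R := 5 * (2 * r.+1 * W)%:R / eps.
have M0 : 0 < M by rewrite divr_gt0 // mulr_gt0 // ltr0n.
have Q0 : 0 < Q by rewrite divr_gt0 // mulr_gt0 // ltr0n !muln_gt0 W0.
have [L L0 LE] := exists_nat_ge ((4 * M ^+ 2 * (2 * Q / eta) + 4 * M ^+ 2) / (eta / 2)).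
(* Starting at [r + W] puts both [r] and [W] below [t 0]; a factor [4^L] per window gives it
   harmonic weight at least [L]. *)
pose t w := ((r + W) * 2 ^ (w * (L * 2)))%N.
have t0E : t 0 = (r + W)%N by rewrite /t mul0n expn0 muln1.
have tS w : t w.+1 = (t w * 2 ^ (L * 2))%N by rewrite /t mulSnr expnD mulnA.
have t_incr w : (t w <= t w.+1)%N by rewrite tS leq_pmulr // expn_gt0.
have t_gt0 w : (0 < t w)%N by rewrite /t muln_gt0 expn_gt0 addn_gt0 r0.
have HL w : L%:R <= harm R (t w) (t w.+1) by rewrite tS harm_pow.
have L1 : 1 <= L%:R :> R by rewrite ler1n.
exists (maxn k (t W)) => n; rewrite geq_max => /andP[kn tWn].
exists (estimator R k W t) => alpha a01; rewrite CUA_Pr.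
have W_le : (W <= t 0)%N by rewrite t0E leq_addl.
have r_le : (r <= t 0)%N by rewrite t0E leq_addr.
apply: (@le_trans _ _ (Pr alpha (@bad R alpha n k r W t M Q eta))).
  apply: Pr_le => // h /=; apply: contraTT => nb.
  rewrite -leNgt {1}etaE.
  apply: (@not_bad R alpha a01 n k r W t M Q L%:R eta) => //.
  by rewrite [leRHS]mulrC -ler_pdivrMr ?divr_gt0.
have p1 := @Pr_bad1 R alpha a01 n k k0 kn.
have p2 := @Pr_bad2 R alpha a01 n k r W t t_incr r_le tWn.
have p3 := @Pr_bad3 R alpha a01 n r W t M W0 M0 t_incr W_le tWn.
have p4 := @Pr_bad4 R alpha a01 n r W t Q L%:R Q0 t_incr L1 HL r_le tWn.
have p5 := @Pr_bad5 R alpha a01 n r W t L%:R eta W0 eta0 t_incr L1 HL W_le r_le tWn.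
have k0R : 0 < k%:R :> R by rewrite ltr0n.
have W0R : 0 < W%:R :> R by rewrite ltr0n.
have e1 : 8 / k%:R <= eps / 5.
  move: kE; rewrite ler_pdivrMr // ler_pdivrMr // => le; lra.
have e2 : 8 * k%:R ^+ 2 / r.+2%:R <= eps / 5.
  move: rE; rewrite ler_pdivrMr // => le; rewrite ler_pdivrMr ?ltr0n //.
  have rz : r%:R <= r.+2%:R :> R by rewrite ler_nat !leqW.
  have := ler_wpM2r (ltW eps0) rz; move: le; move: (r.+2%:R) (k%:R ^+ 2) (r%:R) => z K y.
  clear -eps0; lra.
have e3 : (2 * r.+1 * W.+1)%:R * (7 / M) <= eps / 5.
  have : 0 < (2 * r.+1 * W.+1)%:R :> R by rewrite ltr0n.
  rewrite /M; move: (_%:R) => z z0; rewrite le_eqVlt.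
  by apply/orP; left; apply/eqP; field; rewrite !gt_eqF.
have e4 : (2 * r.+1 * W)%:R * Q^-1 <= eps / 5.
  have : 0 < (2 * r.+1 * W)%:R :> R by rewrite ltr0n !muln_gt0 W0.
  rewrite /Q; move: (_ * W)%N%:R => z z0; rewrite le_eqVlt.
  by apply/orP; left; apply/eqP; field; rewrite !gt_eqF.
have e5 : (r.+1 * r.+1)%:R * (12 / (W%:R * eta ^+ 2)) <= eps / 5.
  move: WE; rewrite ler_pdivrMr ?mulr_gt0 ?exprn_gt0 // => le.
  rewrite mulrA ler_pdivrMr ?mulr_gt0 ?exprn_gt0 //.
  move: le; move: (r.+1 * r.+1)%N%:R (eta ^+ 2) => a b; clear; lra.
apply: le_trans (_ : _ <= eps / 5 + (eps / 5 + (eps / 5 + (eps / 5 + eps / 5)))) _; last by clear; lra.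
apply: le_trans (Pr_or a01 _ _) (lerD (le_trans p1 e1) _).
apply: le_trans (Pr_or a01 _ _) (lerD (le_trans p2 e2) _).
apply: le_trans (Pr_or a01 _ _) (lerD (le_trans p3 e3) _).
exact: le_trans (Pr_or a01 _ _) (lerD (le_trans p4 e4) (le_trans p5 e5)).
Qed.

Theorem theorem1p2 (R : realType) :
  exists alpha_hat : forall n : nat, ugraph n -> ugraph n -> R,
    forall alpha : R, 0 <= alpha <= 1 ->
    forall eps : R, 0 < eps ->
      (fun n : nat =>
         CUA alpha (fun t : ugraph n * ugraph n =>
                      eps < `|alpha_hat n t.1 t.2 - alpha|)) @ \oo --> (0 : R).
Proof.
pose ok n (m : nat) (e : ugraph n -> ugraph n -> R) := forall alpha : R, 0 <= alpha <= 1 ->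
  CUA alpha (fun x : ugraph n * ugraph n => m.+1%:R^-1 < `|e x.1 x.2 - alpha|) <= m.+1%:R^-1.
(* Diagonal choice: [K n] indexes the best accuracy [1 / (m + 1)] with [m <= n] that some estimator
   achieves at size [n] for all [alpha] at once. *)
pose K n := \max_(m < n.+1 | `[< exists e, ok n m e >]) m.
pose alpha_hat n : ugraph n -> ugraph n -> R :=
  if pselect (exists e, ok n (K n) e) is left ex then projT1 (cid ex) else fun _ _ => 0.
exists alpha_hat => alpha a01 eps eps0; apply/cvgrPdist_le => d d0.
have [m0 _ m0E] := exists_nat_ge (Num.min eps d)^-1.
have m0pos : 0 < m0.+1%:R :> R by rewrite ltr0n.
have min0 : 0 < Num.min eps d by rewrite lt_min eps0 d0.
have {}m0E : m0.+1%:R^-1 <= Num.min eps d.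
  rewrite -[leRHS]invrK lef_pV2 ?posrE ?invr_gt0 //.
  by apply: (le_trans m0E); rewrite ler_nat.
have inv0 : 0 < m0.+1%:R^-1 :> R by rewrite invr_gt0.
have [N NE] := uniform_estimator inv0.
near=> n.
have [e oke] : exists e, ok n m0 e by apply: NE; near: n; exact: nbhs_infty_ge.
have m0n : (m0 < n.+1)%N by rewrite ltnS; near: n; exact: nbhs_infty_ge.
have m0K : (m0 <= K n)%N.
  by apply: (@leq_bigmax_cond _ _ (fun i : 'I_n.+1 => i : nat) (Ordinal m0n)); apply/asboolP; exists e.
(* The maximum is attained because [m0] qualifies; over an empty range it would be the default 0. *)
have okK : exists e', ok n (K n) e'.
  have : (0 < #|[pred m : 'I_n.+1 | `[< exists e, ok n m e >]]|)%N.
    by apply/card_gt0P; exists (Ordinal m0n); apply/asboolP; exists e.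
  move=> /(@eq_bigmax_cond _ _ (fun i : 'I_n.+1 => i : nat))[i /asboolP ei eK].
  by rewrite /K eK.
have hok : ok n (K n) (alpha_hat n).
  by rewrite /alpha_hat; case: pselect => // ex; exact: projT2 (cid ex).
have Km : (K n).+1%:R^-1 <= Num.min eps d.
  by apply: le_trans m0E; rewrite lef_pV2 ?posrE ?ltr0n // ler_nat ltnS.
rewrite sub0r normrN CUA_Pr ger0_norm; last by apply: mean_ge0.
apply: le_trans (_ : (K n).+1%:R^-1 <= d); last by apply: (le_trans Km); rewrite ge_min lexx orbT.
apply: le_trans (hok alpha a01); rewrite CUA_Pr; apply: Pr_le => // h /=; apply: le_lt_trans.
by apply: (le_trans Km); rewrite ge_min lexx.
Unshelve. all: by end_near.
Qed.
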